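(* Assume that $C$, $M_K$ and $M_{1,\alpha}$ (defined in the context) are finite. Let $p_0\in C^{1,\alpha}(\mathcal O)$ be the initial density, with $p_0\in\mathcal B_M\subset C^{1,\alpha}(\mathcal O)$, and let $F:\mathcal B_M\to C^{1,\alpha}(\mathcal O)$ be defined by $F(p):=p\,D(p)$. Then the density-valued ordinary differential equation $$\frac{d}{dt}p_t=F(p_t),\qquad p_{t=0}=p_0,$$ admits a unique solution $t\mapsto p_t\in C^1([0,T];C^{1,\alpha}(\mathcal O))$, and $p_t\in\mathcal B_M$ for all $t\in[0,T]$.
   Context: Sample space and data: $d,n\in\mathbb N$ are fixed, $\mathcal O=[0,1]^d\times\{0,1\}\times\{0,1\}$, and $\mu$ is the product of Lebesgue measure on $[0,1]^d$ and counting measures on the two copies of $\{0,1\}$. $O_1,\dots,O_n\in\mathcal O$ are the observations, $O_k=(X_k,A_k,Y_k)$, and $P_nf:=\frac1n\sum_{i=1}^nf(O_i)$. Kernel: $K(o,o')=\exp(-\|o-o'\|_2^2/(2\sigma^2))$ on $\mathcal O\times\mathcal O$, with $\sigma>0$ fixed, is the Gaussian kernel; $\mathcal H_K$ is its reproducing kernel Hilbert space and $k_o=K(o,\cdot)$. Direction: for a probability density $p$ w.r.t. $\mu$, let $P_p$ be the measure with density $p$, $\mathcal H_{K,p}=\{f\in\mathcal H_K:P_p[f]=0\}$ (a closed subspace), $\Pi_p:\mathcal H_K\to\mathcal H_{K,p}$ the orthogonal projection, $k_o^{(p)}=\Pi_pk_o$, $K^{(p)}(o,o')=\langle k_o^{(p)},k_{o'}^{(p)}\rangle_{\mathcal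 H_K}$, $\alpha_j^{(p)}=\frac1n\sum_{i=1}^nK^{(p)}(O_i,O_j)$, and $$D(p):=\frac1n\sum_{j=1}^n\alpha_j^{(p)}\,k_{O_j}^{(p)}.$$ Hölder space: fix $\alpha\in(0,1]$. For $v$ on $[0,1]^d$, $\|v\|_{C^{1,\alpha}}=\|v\|_{L^\infty}+\sum_{i=1}^d\|\nabla_iv\|_{L^\infty}+\sum_{i=1}^d[\nabla_iv]_\alpha$ with $[w]_\alpha=\sup_{x\ne y}|w(x)-w(y)|/\|x-y\|_2^\alpha$. $C^{1,\alpha}(\mathcal O)$ is the Banach space of functions $u$ on $\mathcal O$ with $u(\cdot,a,y)\in C^{1,\alpha}([0,1]^d)$ for all $(a,y)\in\{0,1\}^2$, with norm $\|u\|_{C^{1,\alpha}(\mathcal O)}=\max_{(a,y)}\|u(\cdot,a,y)\|_{C^{1,\alpha}}$. Constants: $M>0$ is a radius (specified below) and $$\mathcal B_M=\Bigl\{p\in C^{1,\alpha}(\mathcal O):p\ge0,\ \int_{\mathcal O}p\,d\mu=1,\ \|p\|_{C^{1,\alpha}(\mathcal O)}\le M\Bigr\},$$ $$C=\sup_{o}K(o,o),\quad M_K=\sup_{y\in\mathcal O}\|K(\cdot,y)\|_{C^{1,\alpha}},\quad M_{1,\alpha}=\sup_{p\in\mathcal B_M}\sup_{1\le j\le n}\|k_{O_j}^{(p)}\|_{C^{1,\alpha}}.$$ Fix $\delta_n>0$ and put $w(\delta_n)=\delta_n/(2CM_{1,\alpha})$. For $k=1,\dots,n$ let $B(O_k,w(\delta_n))=\{(x,A_k,Y_k)\in\mathcal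 O:\|x-X_k\|_2<w(\delta_n)\}$. It is assumed that $p_0$ assigns positive mass to each $B(O_k,w(\delta_n))$. Set $$\mathfrak J(\delta_n)=\max_{1\le k\le n}\Bigl(\int_{B(O_k,w(\delta_n))}p_0\,d\mu\Bigr)^{-1},\qquad T=\frac{2}{\delta_n}\log\bigl(2\mathfrak J(\delta_n)\bigr),$$ $M_0=\|p_0\|_{C^{1,\alpha}(\mathcal O)}$, $C_{\mathrm{alg}}=1+2d^{(1-\alpha)/2}$. The radius $M$ is such that $$M=M_0\exp\bigl(C_{\mathrm{alg}}\,C\,M_{1,\alpha}\,T\bigr).$$ Since $M_{1,\alpha}$ (hence $T$) depends on $M$, this is understood as a relation that the fixed constants satisfy simultaneously. *)

(* Defs.v *)
From HB Require Import structures.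
From mathcomp Require Import all_boot all_order all_algebra.
From mathcomp Require Import all_classical all_reals all_analysis.

Set Implicit Arguments.
Unset Strict Implicit.
Unset Printing Implicit Defensive.

Import Order.TTheory GRing.Theory Num.Theory.
Import numFieldNormedType.Exports.

Local Open Scope classical_set_scope.
Local Open Scope ring_scope.

Record unitI (R : realType) :=
  UnitI { unitI_val :> R ; _ : 0 <= unitI_val <= 1 }.

HB.instance Definition _ (R : realType) := [isSub for @unitI_val R].
HB.instance Definition _ (R : realType) := [Choice of unitI R by <:].

Lemma unitI0_subproof (R : realType) : 0 <= (0 : R) <= 1.
Proof. by rewrite lexx ler01. Qed.

HB.instance Definition _ (R : realType) :=
  isPointed.Build (unitI R) (UnitI (@unitI0_subproof R)).

Section unitI_measurable.
Variable R : realType.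

Let F : set (set (unitI R)) :=
  preimage_set_system setT (@unitI_val R : _ -> measurableTypeR R) measurable.

Let sF : sigma_algebra setT F.
Proof. by apply: sigma_algebra_preimage; exact: sigma_algebra_measurable. Qed.

Let F0 : F set0. Proof. by case: sF. Qed.

Let FC A : F A -> F (~` A).
Proof. by case: sF => _ + _ => /[apply]; rewrite setTD. Qed.

Let FU (A : (set (unitI R))^nat) : (forall i, F (A i)) -> F (\bigcup_i A i).
Proof. by case: sF => _ _; exact. Qed.

HB.instance Definition _ := @isMeasurable.Build
  (preimage_display (@unitI_val R)) (unitI R) F F0 FC FU.

End unitI_measurable.

(* The junk value 0 taken outside [0, 1] is never used: [toI] is only pushed
   forward from [0, 1] and composed with limits within [0, 1]. *)
Definition toI (R : realType) (x : measurableTypeR R) : unitI R :=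
  insubd (UnitI (@unitI0_subproof R)) (x : R).

Lemma measurable_toI (R : realType) :
  measurable_fun [set: measurableTypeR R] (@toI R).
Proof.
move=> _ A [B mB <-]; rewrite !setTI.
have -> : @toI R @^-1` (@unitI_val R @^-1` B) =
    (B `&` `[0, 1]%classic) `|` ([set _ | B 0] `&` ~` `[0, 1]%classic).
  apply/seteqP; split => x /=;
    rewrite /toI in_itv/= -[unitI_val _]/(val _) val_insubd.
    by case: ifP => h; [left|right].
  by case=> -[Bx]; [move=> ->|move/negP/negbTE ->].
apply: measurableU; apply: measurableI => //.
- case: (pselect (B 0)) => h.
    by rewrite (_ : [set _ | _] = setT)//; apply/seteqP; split.
  by rewrite (_ : [set _ | _] = set0)//; apply/seteqP; split.
- exact: measurableC.
Qed.

HB.instance Definition _ (R : realType) :=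
  isMeasurableFun.Build _ _ (measurableTypeR R) (unitI R) (@toI R)
    (@measurable_toI R).

Definition consI (R : realType) d (x : unitI R * d.-tuple (unitI R)) :
  d.+1.-tuple (unitI R) := [tuple of x.1 :: x.2].

Lemma measurable_consI (R : realType) d :
  measurable_fun [set: unitI R * d.-tuple (unitI R)] (@consI R d).
Proof. exact: measurable_cons. Qed.

HB.instance Definition _ (R : realType) d :=
  isMeasurableFun.Build _ _ (unitI R * d.-tuple (unitI R))%type
    (d.+1.-tuple (unitI R)) (@consI R d) (@measurable_consI R d).

Section measures.
Variable R : realType.
Local Open Scope ereal_scope.

Definition lebesgue01 : set (measurableTypeR R) -> \bar R :=
  mrestr (@lebesgue_measure R) (@measurable_itv R `[0%R, 1%R]).

HB.instance Definition _ := Measure.on lebesgue01.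

Lemma lebesgue01_setT : lebesgue01 setT = 1.
Proof.
rewrite /lebesgue01 /mrestr setTI lebesgue_measure_itv/= lte_fin ltr01.
by rewrite oppr0 adde0.
Qed.

HB.instance Definition _ :=
  Measure_isProbability.Build _ _ _ lebesgue01 lebesgue01_setT.

Fixpoint lebesgue_cube d : probability (d.-tuple (unitI R)) R :=
  match d with
  | 0%N => dirac [tuple]
  | d'.+1 =>
      distribution (distribution lebesgue01 (@toI R) \x lebesgue_cube d')
                   (@consI R d')
  end.

Let counting_bool_fin : fin_num_fun (@counting bool R).
Proof.
move=> A _; rewrite /counting; case: ifPn => // /asboolP[].
exact: finite_finset.
Qed.

HB.instance Definition _ :=
  Measure_isFinite.Build _ _ _ (@counting bool R) counting_bool_fin.

End measures.

Definition sample (R : realType) (d : nat) : Type :=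
  (d.-tuple (unitI R) * bool * bool)%type.

Definition sample_measure (R : realType) (d : nat) :
    {measure set sample R d -> \bar R} :=
  ((lebesgue_cube R d \x counting) \x counting)%E.

Section kernel.
Context {R : realType} {d : nat}.

Definition dist2 (x y : d.-tuple (unitI R)) : R :=
  Num.sqrt (\sum_(i < d) ((tnth x i : R) - (tnth y i : R)) ^+ 2).

(* The Euclidean distance of R^(d + 2), with {0, 1} embedded in R. *)
Definition sample_dist (o o' : sample R d) : R :=
  Num.sqrt (dist2 o.1.1 o'.1.1 ^+ 2 + ((o.1.2)%:R - (o'.1.2)%:R) ^+ 2
            + ((o.2)%:R - (o'.2)%:R) ^+ 2).

Definition gauss_kernel (sigma : R) (o o' : sample R d) : R :=
  expR (- (sample_dist o o' ^+ 2 / (2 * sigma ^+ 2))).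

End kernel.

(* [H], with the inner product [ip] (meaningful on [H] only), is the
   reproducing kernel Hilbert space of [K]; by the Moore-Aronszajn theorem it
   exists and is unique whenever [K] is a positive semidefinite kernel. *)
Record is_rkhs (R : realType) (T : Type) (K : T -> T -> R)
    (H : set (T -> R)) (ip : (T -> R) -> (T -> R) -> R) : Prop := IsRKHS {
  rkhs0 : H (fun=> 0) ;
  rkhsP : forall a f g, H f -> H g -> H (fun x => a * f x + g x) ;
  rkhs_ipC : forall f g, H f -> H g -> ip f g = ip g f ;
  rkhs_ipP : forall a f g h, H f -> H g -> H h ->
    ip (fun x => a * f x + g x) h = a * ip f h + ip g h ;
  rkhs_ip_ge0 : forall f, H f -> 0 <= ip f f ;
  rkhs_ip_eq0 : forall f, H f -> ip f f = 0 -> f = fun=> 0 ;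
  rkhs_complete : forall u : nat -> T -> R, (forall n, H (u n)) ->
    (forall eps, 0 < eps -> exists N, forall m n, (N <= m)%N -> (N <= n)%N ->
       ip (u m \- u n) (u m \- u n) <= eps) ->
    exists2 f, H f & (fun n => ip (u n \- f) (u n \- f)) @ \oo --> 0 ;
  rkhs_kernel : forall x, H (K x) ;
  rkhs_reproducing : forall f x, H f -> f x = ip f (K x) }.

(* Orthogonal projection of [f] onto a closed subspace [V]: the unique element
   [g] of [V] such that [f - g] is orthogonal to [V]. *)
Definition orth_proj (R : realType) (T : Type) (ip : (T -> R) -> (T -> R) -> R)
    (V : set (T -> R)) (f : T -> R) : T -> R :=
  xget (fun=> 0) [set g | V g /\ forall h, V h -> ip (f \- g) h = 0].

Section direction.
Context {R : realType} {d n : nat}.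
Variables (K : sample R d -> sample R d -> R) (H : set (sample R d -> R))
  (ip : (sample R d -> R) -> (sample R d -> R) -> R).
Variable O : 'I_n -> sample R d.
Variable p : sample R d -> R.

(* Integral with respect to the measure with density [p]. *)
Definition expect (f : sample R d -> R) : R :=
  \int[sample_measure R d]_o (f o * p o).

Definition rkhs_centered : set (sample R d -> R) :=
  [set f | H f /\ expect f = 0].

Definition centered_section (o : sample R d) : sample R d -> R :=
  orth_proj ip rkhs_centered (K o).

Definition centered_kernel (o o' : sample R d) : R :=
  ip (centered_section o) (centered_section o').

Definition direction_coef (j : 'I_n) : R :=
  n%:R^-1 * \sum_(i < n) centered_kernel (O i) (O j).

Definition direction (o : sample R d) : R :=
  n%:R^-1 * \sum_(j < n) direction_coef j * centered_section (O j) o.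

Definition vector_field (o : sample R d) : R := p o * direction o.

End direction.

Section hoelder_space.
Context {R : realType} {d : nat}.
Implicit Types (v : d.-tuple (unitI R) -> R) (u : sample R d -> R).
Variable alpha : R.

Definition set_coord (i : 'I_d) (x : d.-tuple (unitI R)) (s : unitI R) :
    d.-tuple (unitI R) :=
  [tuple if j == i then s else tnth x j | j < d].

Definition diff_quotient (i : 'I_d) v (x : d.-tuple (unitI R)) (s : R) : R :=
  (v (set_coord i x (toI s)) - v x) / (s - (tnth x i : R)).

(* The limit is taken within [0, 1]: partial derivatives are one-sided on the
   faces of the cube. *)
Definition has_partial (i : 'I_d) v (x : d.-tuple (unitI R)) : Prop :=
  cvg (diff_quotient i v x s @[s --> within `[0, 1] (tnth x i : R)^']).

Definition partial (i : 'I_d) v (x : d.-tuple (unitI R)) : R :=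
  lim (diff_quotient i v x s @[s --> within `[0, 1] (tnth x i : R)^']).

(* A plain supremum: it is the essential supremum for the continuous functions
   it is used with. *)
Definition sup_norm v : \bar R := ereal_sup (range (fun x => `|v x|%:E)).

Definition hoelder_seminorm v : \bar R :=
  ereal_sup [set (`|v xy.1 - v xy.2| / dist2 xy.1 xy.2 `^ alpha)%:E
            | xy in [set xy | xy.1 != xy.2]].

Definition C1a_norm v : \bar R :=
  (sup_norm v + \sum_(i < d) sup_norm (partial i v)
   + \sum_(i < d) hoelder_seminorm (partial i v))%E.

Definition sample_norm u : \bar R :=
  ereal_sup (range (fun ay : bool * bool =>
    C1a_norm (fun x => u (x, ay.1, ay.2)))).

Definition in_C1a u : Prop :=
  (forall a y i x, has_partial i (fun x => u (x, a, y)) x) /\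
  (sample_norm u < +oo)%E.

Definition density_ball (M : R) : set (sample R d -> R) :=
  [set p | [/\ in_C1a p, forall o, 0 <= p o,
               \int[sample_measure R d]_o p o = 1 &
               (sample_norm p <= M%:E)%E]].

(* [p] is a C^1 curve from [[0, T]] to C^{1,alpha}, with derivative [p']. *)
Definition C1_curve (T : R) (p p' : R -> sample R d -> R) : Prop :=
  [/\ forall t, 0 <= t <= T -> in_C1a (p t) /\ in_C1a (p' t),
      forall t, 0 <= t <= T ->
        sample_norm (fun o => (p s o - p t o) / (s - t) - p' t o)
          @[s --> within `[0, T] t^'] --> 0%E &
      forall t, 0 <= t <= T ->
        sample_norm (p' s \- p' t) @[s --> within `[0, T] (nbhs t)] --> 0%E].

Definition kernel_sup (K : sample R d -> sample R d -> R) : \bar R :=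
  ereal_sup (range (fun o => (K o o)%:E)).

Definition kernel_C1a_sup (K : sample R d -> sample R d -> R) : \bar R :=
  ereal_sup (range (fun y => sample_norm (K ^~ y))).

Definition centered_C1a_sup n (K : sample R d -> sample R d -> R)
    (H : set (sample R d -> R))
    (ip : (sample R d -> R) -> (sample R d -> R) -> R)
    (O : 'I_n -> sample R d) (M : R) : \bar R :=
  ereal_sup [set sample_norm (centered_section K H ip pj.1 (O pj.2))
            | pj in density_ball M `*` [set: 'I_n]].

End hoelder_space.

Definition slice_ball (R : realType) d (o : sample R d) (w : R) :
    set (sample R d) :=
  [set o' | [/\ o'.1.2 = o.1.2, o'.2 = o.2 & dist2 o'.1.1 o.1.1 < w]].

Definition inv_mass_max (R : realType) d n (O : 'I_n -> sample R d)
    (p0 : sample R d -> R) (w : R) : R :=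
  \big[Num.max/0]_(k < n)
    (\int[sample_measure R d]_(o in slice_ball (O k) w) p0 o)^-1.

(* [p] is a solution on [[0, T]] of dp/dt = F(p), p(0) = p0, where the vector
   field F(p) = p D(p) is only defined on [density_ball alpha M]. *)
Definition is_solution (R : realType) d n (alpha : R)
    (K : sample R d -> sample R d -> R) (H : set (sample R d -> R))
    (ip : (sample R d -> R) -> (sample R d -> R) -> R)
    (O : 'I_n -> sample R d) (M T : R) (p0 : sample R d -> R)
    (p : R -> sample R d -> R) : Prop :=
  [/\ forall t, 0 <= t <= T -> density_ball alpha M (p t),
      C1_curve alpha T p (fun t => vector_field K H ip O (p t)) &
      p 0 = p0].

(* Main.v *)
Require Import Defs.
From mathcomp Require Import all_boot all_order all_algebra.
From mathcomp Require Import all_classical all_reals all_analysis.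
From mathcomp Require Import measurable_realfun ring lra.

Set Implicit Arguments.
Unset Strict Implicit.
Unset Printing Implicit Defensive.

Import Order.TTheory GRing.Theory Num.Theory.
Import numFieldNormedType.Exports.

(** The solution is the limit of Euler polygons, and the point of the argument is
    that explicit Euler steps do not leave the ball of densities.  A step
    multiplies a density [p] by [1 + h * D], where [D] is the direction at [p].
    The mass is unchanged because [D] is a combination of centered sections, whose
    expectation under [p] vanishes.  The sign is unchanged once [h * D] is bounded
    by 1.  In the product estimate of C^{1,alpha} the factor is at most
    [1 + h * Lambda], with [Lambda] the product of [1 + 2 * d^((1 - alpha) / 2)] and
    of the supremum of the norms of the centered sections (the coefficients of the
    direction are at most 1, because orthogonal projections contract).  Along [k]
    steps of total length at most [T] the norm therefore stays below
    [M0 * exp (Lambda * T)], which is the radius [M] ([euler_step_ball],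
    [solution_exists]).

    The polygons converge because the vector field is Lipschitz on the ball
    ([vector_field_lipschitz]).  In the reproducing kernel Hilbert space the
    expectation under [p] is represented by the mean embedding
    [m_p = \int K(., o) p(o)] ([mean_embedding_rkhs]), so the centered section at
    [o] is [K(o, .) - (m_p(o) / |m_p|^2) m_p] ([centered_sectionE]).  This depends
    on [p] only through integrals against the kernel: [m_p] is linear in [p], with
    values in C^{1,alpha} by differentiation under the integral sign
    ([C1a_le_integral]), and [|m_p|^2] is bounded below because the Gaussian
    kernel is positive on a bounded set.  Hence the direction is even Lipschitz
    from the supremum distance to C^{1,alpha} ([lip_direction]).

    The Euler scheme is treated for a Lipschitz field on a complete set of a normed
    space ([euler_solution]): the nodes satisfy the differential equation up to an
    error quadratic in the elapsed time, successive refinements differ by a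
    multiple of the step by a discrete Gronwall inequality, and the quadratic
    estimate passes to the limit.  Uniqueness ([solution_unique]) only needs the
    supremum distance, in which solutions can be compared pointwise by the mean
    value theorem for real functions. *)

Local Open Scope classical_set_scope.
Local Open Scope ring_scope.

(** * One-sided derivatives on a segment *)

Section one_sided_derivative.
Context {R : realType}.
Implicit Types (f : R -> R) (a b t l : R).

(** Partial derivatives on the faces of the cube and time derivatives at the ends
    of the time interval are both limits of this kind. *)
Definition deriv_within a b f t l : Prop :=
  (f s - f t) / (s - t) @[s --> within `[a, b] t^'] --> l.

Lemma near_within_itv a b t (P : R -> Prop) :
  (\forall s \near within `[a, b] t^', P s) <->
  exists2 e : R, 0 < e &
    forall s, a <= s <= b -> s != t -> `|s - t| <= e -> P s.
Proof.
rewrite /within/= /dnbhs /within/=; split.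
- move=> /nbhs_ballP[e /= e0 he]; exists (e / 2); first by rewrite divr_gt0.
  move=> s sab st se; apply: (he s _ st); last by rewrite /= in_itv.
  by rewrite /ball/= distrC; apply: le_lt_trans se _; lra.
- move=> [e e0 he]; apply/nbhs_ballP; exists e => //= s.
  rewrite /ball/= distrC => /ltW se st; rewrite in_itv/= => sab.
  exact: he.
Qed.

Lemma deriv_withinP a b f t l : deriv_within a b f t l <->
  forall eps, 0 < eps -> exists2 e : R, 0 < e &
    forall s, a <= s <= b -> s != t -> `|s - t| <= e ->
      `|(f s - f t) / (s - t) - l| <= eps.
Proof.
split=> [/cvgrPdist_le h eps e0|h].
- have /near_within_itv[e e_gt0 he] := h _ e0.
  by exists e => // s sab st se; rewrite distrC; exact: he.
- apply/cvgrPdist_le => eps e0; have [e e_gt0 he] := h _ e0.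
  apply/near_within_itv; exists e => // s sab st se.
  by rewrite distrC; exact: he.
Qed.

Lemma dnbhs_within_proper a b t : a < b -> a <= t <= b ->
  ProperFilter (within `[a, b] t^').
Proof.
move=> ab /andP[at_ tb]; apply: Build_ProperFilter_ex.
move=> P /near_within_itv[e e0 he].
have near_pt r : a <= r <= b -> 0 < `|r - t| <= e -> exists s, P s.
  move=> rab /andP[rt re]; exists r; apply: he => //.
  by rewrite -subr_eq0 -normr_gt0.
have [tb'|bt] := ltP t b.
- have [h|h] := leP e (b - t).
  + by apply: (near_pt (t + e)); rewrite ?[t + e - t]addrC ?addKr ?gtr0_norm; lra.
  + by apply: (near_pt b); rewrite ?gtr0_norm; lra.
- have [h|h] := leP e (b - a).
  + by apply: (near_pt (t - e)); rewrite ?[t - e - t]addrC ?addKr ?normrN ?gtr0_norm; lra.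
  + by apply: (near_pt a); rewrite ?ltr0_norm; lra.
Qed.

(** A function with one-sided derivatives on a segment satisfies the hypotheses
    of the mean value theorem: inside the segment the punctured neighbourhoods
    within the segment are the usual ones. *)
Lemma mean_value_within a b f df : a < b ->
  (forall t, a <= t <= b -> deriv_within a b f t (df t)) ->
  exists2 c, a < c < b & f b - f a = df c * (b - a).
Proof.
move=> ab fd.
have [||c] := @MVT R f df a b ab; last by rewrite in_itv/=; exists c.
- move=> x; rewrite in_itv/= => /andP[ax xb].
  have cvx : h^-1 *: ((f \o shift x) (h *: (1 : R)) - f x) @[h --> 0^'] --> df x.
    apply/cvgrPdist_le => eps e0.
    have axb : a <= x <= b by rewrite !ltW.
    have /deriv_withinP/(_ _ e0)[e e_gt0 he] := fd x axb.
    near=> h.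
    have h0 : h != 0 by near: h; exact: nbhs_dnbhs_neq.
    have hm : `|h| <= Num.min e (Num.min (x - a) (b - x)).
      near: h; apply: dnbhs0_le; rewrite !lt_min e_gt0/=; lra.
    move: hm; rewrite !le_min => /andP[he' /andP[]].
    move=> /ler_normlP[h1 h2] /ler_normlP[h3 h4].
    rewrite distrC /= scaler1.
    have := he (h + x); rewrite addrK => /(_ _ _ he').
    rewrite [(_ - _) / _]mulrC; apply; first by lra.
    by rewrite -subr_eq0 addrK.
  split; [by apply/cvg_ex; exists (df x)|exact: cvg_lim].
- apply/subspace_continuousP => x; rewrite /= in_itv/= => xab.
  apply/cvgrPdist_le => eps e0.
  have /deriv_withinP/(_ _ ltr01)[e e_gt0 he] := fd x xab.
  set L := `|df x| + 1.
  have L0 : 0 < L by rewrite ltr_wpDl.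
  rewrite near_withinE; apply/nbhs_ballP; exists (Num.min e (eps / L)) => /=.
    by rewrite lt_min e_gt0 divr_gt0.
  move=> y; rewrite /ball/= lt_min => /andP[/ltW ye /ltW yeps].
  rewrite in_itv/= => yab.
  have [->|yx] := eqVneq y x; first by rewrite subrr normr0 ltW.
  have := he _ yab yx; rewrite distrC => /(_ ye) hq.
  have dL : `|(f y - f x) / (y - x)| <= L.
    rewrite -[X in `|X|](subrK (df x)) (le_trans (ler_normD _ _))//.
    by rewrite /L addrC lerD2l.
  move: yeps; rewrite distrC ler_pdivlMr// => yeps.
  have yx0 : y - x != 0 by rewrite subr_eq0.
  rewrite distrC -[f y - f x](divfK yx0) normrM (le_trans _ yeps)//.
  by rewrite mulrC ler_wpM2l.
Unshelve. all: by end_near.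
Qed.

Lemma deriv_within_sub a b a' b' f t l : a <= a' -> b' <= b ->
  deriv_within a b f t l -> deriv_within a' b' f t l.
Proof.
move=> aa bb /deriv_withinP h; apply/deriv_withinP => eps /h[e e0 he].
exists e => // s /andP[as_ sb]; apply: he.
by rewrite (le_trans aa)//= (le_trans sb).
Qed.

(** With [c] the derivative at [x] and [B] the oscillation of the derivative
    between [x] and [y], this compares a difference quotient with the derivative;
    with [c = 0] it is the usual Lipschitz bound. *)
Lemma mean_value_bound a b f df c B x y :
  (forall t, a <= t <= b -> deriv_within a b f t (df t)) ->
  a <= x <= b -> a <= y <= b ->
  (forall t, a <= t <= b -> `|t - x| <= `|y - x| -> `|df t - c| <= B) ->
  `|f y - f x - c * (y - x)| <= B * `|y - x|.
Proof.
move=> fd /andP[ax xb] /andP[ay yb] dB.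
have key u v : a <= u -> v <= b -> u < v ->
    exists2 t, u < t < v & f v - f u = df t * (v - u).
  move=> au vb uv; apply: mean_value_within => // t /andP[ut tv].
  by apply: (@deriv_within_sub a b) => //; apply: fd; apply/andP; split; lra.
have [xy|yx|->] := ltgtP x y; last by rewrite !subrr mulr0 subr0 !normr0 mulr0.
- have [t /andP[xt ty] ->] := key _ _ ax yb xy.
  rewrite -mulrBl normrM ler_wpM2r// dB//; first by apply/andP; split; lra.
  by rewrite !gtr0_norm; lra.
- have [t /andP[xt ty]] := key _ _ ay xb yx.
  rewrite -opprB => /eqP; rewrite eqr_oppLR => /eqP ->.
  rewrite -mulrN opprB -mulrBl normrM ler_wpM2r// dB//.
    by apply/andP; split; lra.
  by rewrite !ltr0_norm; lra.
Qed.

End one_sided_derivative.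

(** * Partial derivatives on the cube *)

Section partial_derivatives.
Context {R : realType} {d : nat}.
Implicit Types (v : d.-tuple (unitI R) -> R) (x y : d.-tuple (unitI R)).
Implicit Types (g : 'I_d -> d.-tuple (unitI R) -> R) (i : 'I_d) (s : unitI R).

Lemma unitI_itv s : 0 <= (s : R) <= 1.
Proof. by case: s. Qed.

Lemma toI_val (r : R) : 0 <= r <= 1 -> (toI r : R) = r.
Proof. by move=> r01; rewrite /toI -[unitI_val _]/(val _) val_insubd r01. Qed.

Lemma toIK s : toI (s : R) = s.
Proof. by apply: val_inj => /=; rewrite toI_val// unitI_itv. Qed.

Lemma set_coord_id i x : set_coord i x (tnth x i) = x.
Proof.
by apply: eq_from_tnth => j; rewrite tnth_mktuple; case: eqP => // ->.
Qed.

Lemma tnth_set_coord i x s : tnth (set_coord i x s) i = s.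
Proof. by rewrite tnth_mktuple eqxx. Qed.

Lemma set_coord_set i x s s' : set_coord i (set_coord i x s) s' = set_coord i x s'.
Proof. by apply: eq_from_tnth => j; rewrite !tnth_mktuple; case: eqP. Qed.

Lemma dist2_ge0 x y : 0 <= dist2 x y.
Proof. exact: sqrtr_ge0. Qed.

Lemma dist2_sqr x y :
  dist2 x y ^+ 2 = \sum_(i < d) ((tnth x i : R) - (tnth y i : R)) ^+ 2.
Proof. by rewrite sqr_sqrtr// sumr_ge0// => i _; rewrite sqr_ge0. Qed.

Lemma dist2_coord x y i : `|(tnth x i : R) - (tnth y i : R)| <= dist2 x y.
Proof.
rewrite -sqrtr_sqr ler_sqrt; last by apply: sumr_ge0 => j _; rewrite sqr_ge0.
by rewrite (bigD1 i)//= lerDl sumr_ge0// => j _; rewrite sqr_ge0.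
Qed.

Lemma dist2_le_sum x y :
  dist2 x y <= \sum_(i < d) `|(tnth x i : R) - (tnth y i : R)|.
Proof.
have S0 : 0 <= \sum_(i < d) `|(tnth x i : R) - (tnth y i : R)| by exact: sumr_ge0.
rewrite -(ger0_norm S0) -sqrtr_sqr ler_sqrt ?sqr_ge0//.
suff [] : 0 <= \sum_(i < d) `|(tnth x i : R) - (tnth y i : R)| /\
  \sum_(i < d) ((tnth x i : R) - (tnth y i : R)) ^+ 2 <=
  (\sum_(i < d) `|(tnth x i : R) - (tnth y i : R)|) ^+ 2 by [].
elim/big_rec2 : _ => [|i a b _ [b0 ab]]; first by rewrite expr0n.
split; first exact: addr_ge0.
rewrite -real_normK ?num_real// sqrrD -addrA lerD2l ler_wpDl//.
by rewrite mulrn_wge0// mulr_ge0.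
Qed.

Lemma dist2_set_coord i x s : dist2 (set_coord i x s) x = `|(s : R) - (tnth x i : R)|.
Proof.
rewrite -sqrtr_sqr; congr Num.sqrt; rewrite (bigD1 i)//= tnth_set_coord.
rewrite big1 ?addr0// => j ji.
by rewrite tnth_mktuple (negPf ji) subrr expr0n.
Qed.

Lemma dist2_diam x y : dist2 x y <= Num.sqrt d%:R.
Proof.
rewrite ler_sqrt ?ler0n// -[X in _ <= X%:R]card_ord -sum1_card natr_sum.
apply: ler_sum => i _; rewrite -real_normK ?num_real// expr_le1//.
by have := unitI_itv (tnth x i); have := unitI_itv (tnth y i); rewrite ler_norml; lra.
Qed.

Definition is_partial i v x (l : R) : Prop :=
  diff_quotient i v x t @[t --> within `[0, 1] (tnth x i : R)^'] --> l.

Definition has_grad v g : Prop := forall i x, is_partial i v x (g i x).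

(** A partial derivative on the cube is a one-sided derivative, within the unit
    interval, of the restriction of the function to a segment parallel to an
    axis; the points of that segment share this restriction. *)
Lemma is_partialP v i x (r l : R) : 0 <= r <= 1 ->
  is_partial i v (set_coord i x (toI r)) l <->
  deriv_within 0 1 (fun s : R => v (set_coord i x (toI s))) r l.
Proof.
move=> r01; rewrite /is_partial tnth_set_coord toI_val// /deriv_within.
suff -> : diff_quotient i v (set_coord i x (toI r)) =
    (fun t => (v (set_coord i x (toI t)) - v (set_coord i x (toI r))) / (t - r)) by [].
by apply/funext => t; rewrite /diff_quotient set_coord_set tnth_set_coord toI_val.
Qed.

Lemma has_gradP v g : has_grad v g <-> forall i x (r : R), 0 <= r <= 1 ->
  deriv_within 0 1 (fun s : R => v (set_coord i x (toI s))) r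
    (g i (set_coord i x (toI r))).
Proof.
split=> [h i x r r01|h i x].
  exact: (iffLR (is_partialP _ _ _ _ r01) (h i _)).
have h' := h i x _ (unitI_itv (tnth x i)).
have := iffRL (is_partialP _ _ _ _ (unitI_itv (tnth x i))) h'.
by rewrite toIK set_coord_id.
Qed.

Lemma partial_proper i x : ProperFilter (within `[0, 1] (tnth x i : R)^').
Proof. exact: dnbhs_within_proper ltr01 (unitI_itv _). Qed.

Lemma has_grad_partial v g i x : has_grad v g -> partial i v x = g i x.
Proof.
move=> h; have := @partial_proper i x => PF.
exact: cvg_lim (h i x).
Qed.

Lemma has_partial_grad v :
  (forall i x, has_partial i v x) <-> has_grad v (fun i => partial i v).
Proof.
split=> [h i x|h i x]; first exact: h.
by apply/cvg_ex; exists (partial i v x); exact: h.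
Qed.

Lemma is_partial_epsP v i x (l : R) : is_partial i v x l <->
  forall eps, 0 < eps -> exists2 e : R, 0 < e &
    forall s, s != tnth x i -> `|(s : R) - (tnth x i : R)| <= e ->
      `|(v (set_coord i x s) - v x) / ((s : R) - (tnth x i : R)) - l| <= eps.
Proof.
split=> [/cvgrPdist_le vl eps e0|vl].
- have /near_within_itv[e e_gt0 he] := vl _ e0.
  exists e => // s sx se; rewrite distrC.
  have sx' : (s : R) != (tnth x i : R) by apply: contra sx => /eqP/val_inj ->.
  by have := he (unitI_val s) (unitI_itv s) sx' se; rewrite /diff_quotient toIK.
- apply/cvgrPdist_le => eps e0; have [e e_gt0 he] := vl _ e0.
  apply/near_within_itv; exists e => // s s01 sx se.
  have sx' : toI s != tnth x i by apply: contra sx => /eqP <-; rewrite toI_val.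
  by rewrite distrC; have := he _ sx'; rewrite toI_val//; exact.
Qed.

Lemma partial_mean_value v g i x s (c B : R) : has_grad v g ->
  (forall r : unitI R, `|(r : R) - (tnth x i : R)| <= `|(s : R) - (tnth x i : R)| ->
    `|g i (set_coord i x r) - c| <= B) ->
  `|v (set_coord i x s) - v x - c * ((s : R) - (tnth x i : R))| <=
    B * `|(s : R) - (tnth x i : R)|.
Proof.
move=> /has_gradP vg gB.
have := @mean_value_bound R 0 1 (fun r : R => v (set_coord i x (toI r)))
  (fun r => g i (set_coord i x (toI r))) c B
  (unitI_val (tnth x i)) (unitI_val s) (vg i x)
  (unitI_itv _) (unitI_itv _).
rewrite !toIK set_coord_id; apply => t t01 ts; apply: gB.
by rewrite toI_val.
Qed.

(** Coordinates below [k] are those of [y], the others those of [x]: moving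
    [k] from [0] to [d] leads from [x] to [y] along the coordinate axes. *)
Definition mix_coord x y (k : nat) : d.-tuple (unitI R) :=
  [tuple if (j < k)%N then tnth y j else tnth x j | j < d].

Lemma mix_coordS x y i :
  mix_coord x y i.+1 = set_coord i (mix_coord x y i) (tnth y i).
Proof.
apply: eq_from_tnth => j; rewrite !tnth_mktuple ltnS leq_eqVlt.
by rewrite (inj_eq val_inj); have [->|] := eqVneq j i.
Qed.

(** From [x] to [y] one coordinate is moved at a time, and each move is bounded
    by the mean value theorem. *)
Lemma grad_lipschitz v g (b : 'I_d -> R) x y : has_grad v g ->
  (forall i z, `|g i z| <= b i) ->
  `|v x - v y| <= (\sum_(i < d) b i) * dist2 x y.
Proof.
move=> vg gb.
have mix0 : mix_coord x y 0 = x by apply: eq_from_tnth => j; rewrite tnth_mktuple.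
have mixd : mix_coord x y d = y.
  by apply: eq_from_tnth => j; rewrite tnth_mktuple ltn_ord.
have := telescope_sumr (fun k => v (mix_coord x y k)) (leq0n d).
rewrite distrC mix0 mixd => <-.
rewrite big_mkord mulr_suml (le_trans (ler_norm_sum _ _ _))//.
apply: ler_sum => i _; rewrite mix_coordS.
have xi : tnth (mix_coord x y i) i = tnth x i by rewrite tnth_mktuple ltnn.
have := @partial_mean_value v g i (mix_coord x y i) (tnth y i) 0 (b i) vg.
rewrite mul0r subr0 xi => /(_ _)/le_trans; apply.
- by move=> r _; rewrite subr0.
- by rewrite ler_wpM2l ?(le_trans (normr_ge0 _) (gb i x))// distrC dist2_coord.
Qed.

End partial_derivatives.

Section partial_algebra.
Context {R : realType} {d : nat}.
Implicit Types (u v : d.-tuple (unitI R) -> R) (x y : d.-tuple (unitI R)).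
Implicit Types (i : 'I_d).

Lemma is_partialD u v i x l m : is_partial i u x l -> is_partial i v x m ->
  is_partial i (u + v) x (l + m).
Proof.
move=> ul vm; rewrite /is_partial.
have -> : diff_quotient i (u + v) x =
    (fun t => diff_quotient i u x t + diff_quotient i v x t).
  by apply/funext => t; rewrite /diff_quotient -mulrDl !fctE; congr (_ / _); ring.
exact: cvgD.
Qed.

Lemma is_partialZ c u i x l : is_partial i u x l -> is_partial i (c *: u) x (c * l).
Proof.
move=> ul; rewrite /is_partial.
have -> : diff_quotient i (c *: u) x = (fun t => c * diff_quotient i u x t).
  by apply/funext => t; rewrite /diff_quotient mulrA mulrBr.
by apply: cvgM => //; exact: cvg_cst.
Qed.

Lemma is_partialB u v i x l m : is_partial i u x l -> is_partial i v x m ->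
  is_partial i (u - v) x (l - m).
Proof.
move=> ul /(is_partialZ (c := -1)); rewrite scaleN1r mulN1r; exact: is_partialD.
Qed.

Lemma is_partialM u v i x l m : is_partial i u x l -> is_partial i v x m ->
  is_partial i (u * v) x (l * v x + u x * m).
Proof.
move=> ul vm; rewrite /is_partial.
have vE t : v (set_coord i x (toI t)) =
    v x + diff_quotient i v x t * (t - (tnth x i : R)).
  rewrite /diff_quotient; have [->|tx] := eqVneq t (tnth x i : R).
    by rewrite toIK set_coord_id subrr mul0r mul0r addr0.
  by rewrite divfK ?subr_eq0// addrC subrK.
have -> : diff_quotient i (u * v) x = (fun t => diff_quotient i u x t *
    (v x + diff_quotient i v x t * (t - (tnth x i : R))) +
    u x * diff_quotient i v x t).
  by apply/funext => t; rewrite -vE /diff_quotient !fctE; ring.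
have t0 : t - (tnth x i : R) @[t --> within `[0, 1] (tnth x i : R)^'] --> 0.
  apply/cvgrPdist_le => eps e0; apply/near_within_itv; exists eps => // s _ _.
  by rewrite sub0r normrN.
apply: cvgD; last by apply: cvgM => //; exact: cvg_cst.
apply: cvgM => //.
rewrite [X in _ --> X](_ : _ = v x + m * 0); last by rewrite mulr0 addr0.
by apply: cvgD; [exact: cvg_cst|exact: cvgM].
Qed.

End partial_algebra.

(** * Bounds for the norm of C^{1,alpha} on the cube *)

Section hoelder_norm.
Context {R : realType} {d : nat}.
Variable alpha : R.
Hypotheses (alpha_gt0 : 0 < alpha) (alpha_le1 : alpha <= 1).
Implicit Types (u v : d.-tuple (unitI R) -> R) (x y : d.-tuple (unitI R)).
Implicit Types (g : 'I_d -> d.-tuple (unitI R) -> R) (i : 'I_d).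

(** The function, its partial derivatives and their Hölder seminorms are bounded
    separately because the product rule mixes the three kinds of bounds. *)
Definition C1a_bound v g (b0 : R) (b1 b2 : 'I_d -> R) : Prop :=
  [/\ has_grad v g, forall x, `|v x| <= b0, forall i x, `|g i x| <= b1 i,
      forall i x y, `|g i x - g i y| <= b2 i * dist2 x y `^ alpha &
      forall i, 0 <= b2 i].

Lemma C1a_bound_ge0 v g b0 b1 b2 : C1a_bound v g b0 b1 b2 ->
  [/\ 0 <= b0, forall i, 0 <= b1 i & forall i, 0 <= b2 i].
Proof.
pose x0 : d.-tuple (unitI R) := [tuple (toI 0) | _ < d].
case=> _ h0 h1 _ h2; split=> // [|i].
- exact: le_trans (h0 x0).
- exact: le_trans (h1 i x0).
Qed.

Lemma dist2_powR_gt0 x y : x != y -> 0 < dist2 x y `^ alpha.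
Proof.
move=> xy; apply: powR_gt0; rewrite lt_neqAle dist2_ge0 andbT eq_sym.
apply: contra xy => /eqP d0; apply/eqP/eq_from_tnth => i; apply/val_inj/eqP.
by rewrite -subr_eq0 -normr_le0 (le_trans (dist2_coord x y i))// d0.
Qed.

Lemma sup_norm_ge0 v : (0 <= sup_norm v)%E.
Proof.
pose x : d.-tuple (unitI R) := [tuple (toI 0) | _ < d].
apply: le_ereal_sup_tmp; exists (`|v x|%:E); first by exists x.
by rewrite lee_fin.
Qed.

(** The index [i] excludes the zero-dimensional cube, where the supremum over
    the pairs of distinct points is -oo. *)
Lemma hoelder_seminorm_ge0 i v : (0 <= hoelder_seminorm alpha v)%E.
Proof.
pose x : d.-tuple (unitI R) := [tuple (toI 0) | _ < d].
pose y := set_coord i x (toI 1).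
apply: le_ereal_sup_tmp; exists (`|v x - v y| / dist2 x y `^ alpha)%:E.
  exists (x, y) => //=; apply/eqP => /(congr1 (fun z => unitI_val (tnth z i))).
  rewrite tnth_set_coord tnth_mktuple !toI_val ?lexx ?ler01// => /eqP.
  by rewrite eq_sym oner_eq0.
by rewrite lee_fin divr_ge0// powR_ge0.
Qed.

Lemma C1a_norm_ge0 v : (0 <= C1a_norm alpha v)%E.
Proof.
by rewrite /C1a_norm !adde_ge0 ?sup_norm_ge0// sume_ge0// => i _;
  rewrite ?sup_norm_ge0 ?(hoelder_seminorm_ge0 i).
Qed.

Lemma C1a_normP v (c : R) :
  (exists g b0 b1 b2, C1a_bound v g b0 b1 b2 /\
     b0 + \sum_i b1 i + \sum_i b2 i <= c) <->
  (forall i x, has_partial i v x) /\ (C1a_norm alpha v <= c%:E)%E.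
Proof.
split.
- move=> [g [b0 [b1 [b2 [[vg h0 h1 h2 h20] bc]]]]].
  have vp i : partial i v = g i.
    by apply/funext => x; exact: has_grad_partial.
  split; first by move=> i x; apply/cvg_ex; exists (g i x); exact: vg.
  apply: (@le_trans _ _ (b0 + \sum_i b1 i + \sum_i b2 i)%:E); last by rewrite lee_fin.
  rewrite !EFinD /C1a_norm -!sumEFin; apply: leeD; first apply: leeD.
  + by apply: ge_ereal_sup => _ [x _ <-]; rewrite lee_fin.
  + apply: lee_sum => i _; apply: ge_ereal_sup => _ [x _ <-].
    by rewrite lee_fin vp.
  + apply: lee_sum => i _; apply: ge_ereal_sup => _ [[x y] /= xy <-].
    by rewrite lee_fin vp ler_pdivrMr ?dist2_powR_gt0.
- case=> /has_partial_grad vg vc.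
  have s0 (f : d.-tuple (unitI R) -> R) := sup_norm_ge0 f.
  have h0 := hoelder_seminorm_ge0.
  have S1 : (0 <= \sum_i sup_norm (partial i v))%E by apply: sume_ge0 => i _.
  have S2 : (0 <= \sum_i hoelder_seminorm alpha (partial i v))%E.
    by apply: sume_ge0 => i _; exact: h0.
  have part (f : 'I_d -> \bar R) i : (forall j, 0 <= f j)%E -> (f i <= \sum_j f j)%E.
    by move=> f0; rewrite (bigD1 i)//= leeDl// sume_ge0.
  have small e : (0 <= e)%E -> (e <= C1a_norm alpha v)%E -> (fine e)%:E = e.
    move=> e0 ev; rewrite fineK// ge0_fin_numE//.
    exact: le_lt_trans (le_trans ev vc) (ltry c).
  have fin0 : (fine (sup_norm v))%:E = sup_norm v.
    by apply: small => //; rewrite /C1a_norm -addeA leeDl// adde_ge0.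
  have fin1 i : (fine (sup_norm (partial i v)))%:E = sup_norm (partial i v).
    apply: small => //.
    apply: le_trans (part (fun j => sup_norm (partial j v)) i _) _ => //.
    by rewrite /C1a_norm addeAC leeDr// adde_ge0.
  have fin2 i : (fine (hoelder_seminorm alpha (partial i v)))%:E =
      hoelder_seminorm alpha (partial i v).
    apply: small; first exact: h0.
    apply: le_trans (part (fun j => hoelder_seminorm alpha (partial j v)) i _) _.
      by move=> j; exact: h0.
    by rewrite /C1a_norm leeDr// adde_ge0.
  exists (fun i => partial i v), (fine (sup_norm v)),
    (fun i => fine (sup_norm (partial i v))),
    (fun i => fine (hoelder_seminorm alpha (partial i v))).
  split; last first.
    rewrite -lee_fin !EFinD -!sumEFin fin0.
    by under eq_bigr do rewrite fin1; under [X in (_ + X)%E]eq_bigr do rewrite fin2.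
  split=> // [x|i x|i x y|i].
  + by rewrite -lee_fin fin0; apply: ereal_sup_ubound; exists x.
  + by rewrite -lee_fin fin1; apply: ereal_sup_ubound; exists x.
  + have [->|xy] := eqVneq x y.
      by rewrite subrr normr0 mulr_ge0 ?powR_ge0// fine_ge0// h0.
    rewrite -ler_pdivrMr ?dist2_powR_gt0// -lee_fin fin2.
    by apply: ereal_sup_ubound; exists (x, y).
  + exact/fine_ge0/h0.
Qed.

(** The power [1 - alpha] of the diameter of the cube. *)
Definition hoelder_diam : R := d%:R `^ ((1 - alpha) / 2).

Lemma hoelder_diam_ge0 : 0 <= hoelder_diam.
Proof. exact: powR_ge0. Qed.

Lemma dist2_hoelder x y : dist2 x y <= hoelder_diam * dist2 x y `^ alpha.
Proof.
have [->|d0] := eqVneq (dist2 x y) 0.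
  by rewrite mulr_ge0 ?powR_ge0.
rewrite -{1}(powRr1 (dist2_ge0 x y)) -{1}(subrK alpha 1) powRD ?d0 ?implybT//.
rewrite ler_wpM2r ?powR_ge0// /hoelder_diam [(1 - alpha) / 2]mulrC powRrM powR12_sqrt ?ler0n//.
by rewrite ge0_ler_powR ?nnegrE ?subr_ge0 ?dist2_ge0 ?sqrtr_ge0 ?dist2_diam.
Qed.

Lemma C1a_boundD u v gu gv a0 b0 a1 b1 a2 b2 :
  C1a_bound u gu a0 a1 a2 -> C1a_bound v gv b0 b1 b2 ->
  C1a_bound (u + v) (fun i => gu i + gv i) (a0 + b0)
    (fun i => a1 i + b1 i) (fun i => a2 i + b2 i).
Proof.
move=> [ug ha0 ha1 ha2 a20] [vg hb0 hb1 hb2 b20]; split=> [i x|x|i x|i x y|i].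
- exact: is_partialD.
- by rewrite (le_trans (ler_normD _ _))// lerD.
- by rewrite (le_trans (ler_normD _ _))// lerD.
- rewrite mulrDl [X in `|X|](_ : _ = (gu i x - gu i y) + (gv i x - gv i y)).
    by rewrite (le_trans (ler_normD _ _))// lerD.
  by rewrite !fctE; ring.
- exact: addr_ge0.
Qed.

Lemma C1a_boundZ c v gv b0 b1 b2 : C1a_bound v gv b0 b1 b2 ->
  C1a_bound (c *: v) (fun i => c *: gv i) (`|c| * b0) (fun i => `|c| * b1 i)
    (fun i => `|c| * b2 i).
Proof.
move=> [vg hb0 hb1 hb2 b20]; split=> [i x|x|i x|i x y|i].
- exact: is_partialZ.
- by rewrite normrM ler_wpM2l.
- by rewrite normrM ler_wpM2l.
- by rewrite -mulrBr normrM -mulrA ler_wpM2l.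
- exact: mulr_ge0.
Qed.

(** The Hölder seminorm of the product involves those of the factors, which are
    Lipschitz; on the cube, of diameter the square root of [d], the Lipschitz
    bound yields a Hölder bound at the price of the factor [hoelder_diam]. *)
Lemma C1a_boundM u v gu gv a0 b0 a1 b1 a2 b2 :
  C1a_bound u gu a0 a1 a2 -> C1a_bound v gv b0 b1 b2 ->
  C1a_bound (u * v) (fun i => gu i * v + u * gv i) (a0 * b0)
    (fun i => a1 i * b0 + a0 * b1 i)
    (fun i => a2 i * b0 + a0 * b2 i +
       hoelder_diam * (a1 i * (\sum_j b1 j) + b1 i * (\sum_j a1 j))).
Proof.
move=> ub vb; have [a00 a10 a20] := C1a_bound_ge0 ub.
have [b00 b10 b20] := C1a_bound_ge0 vb.
case: ub vb => ug ha0 ha1 ha2 _ [vg hb0 hb1 hb2 _].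
have hold w gw (c : 'I_d -> R) x y : has_grad w gw ->
    (forall i z, `|gw i z| <= c i) -> (forall i, 0 <= c i) ->
    `|w x - w y| <= (\sum_j c j) * hoelder_diam * dist2 x y `^ alpha.
  move=> wg wc c0; apply: le_trans (grad_lipschitz _ _ wg wc) _.
  by rewrite -mulrA ler_wpM2l ?sumr_ge0// dist2_hoelder.
split=> [i x|x|i x|i x y|i].
- exact: is_partialM.
- by rewrite normrM ler_pM.
- by rewrite (le_trans (ler_normD _ _))// lerD// normrM ler_pM.
- have -> : (gu i * v + u * gv i) x - (gu i * v + u * gv i) y =
      (gu i x - gu i y) * v x + gu i y * (v x - v y) +
      (u x * (gv i x - gv i y) + gv i y * (u x - u y)).
    by rewrite !fctE; ring.
  apply: le_trans (ler_normD _ _) _; apply: le_trans (lerD (ler_normD _ _) (ler_normD _ _)) _.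
  rewrite !normrM.
  have e1 := ler_pM (normr_ge0 _) (normr_ge0 _) (ha2 i x y) (hb0 x).
  have e2 := ler_pM (normr_ge0 _) (normr_ge0 _) (ha1 i y) (hold _ _ _ x y vg hb1 b10).
  have e3 := ler_pM (normr_ge0 _) (normr_ge0 _) (ha0 x) (hb2 i x y).
  have e4 := ler_pM (normr_ge0 _) (normr_ge0 _) (hb1 i y) (hold _ _ _ x y ug ha1 a10).
  apply: le_trans (lerD (lerD e1 e2) (lerD e3 e4)) _.
  by rewrite le_eqVlt; apply/orP; left; apply/eqP; ring.
- by rewrite !addr_ge0 ?mulr_ge0 ?addr_ge0 ?mulr_ge0 ?sumr_ge0 ?hoelder_diam_ge0.
Qed.

End hoelder_norm.

(** * The space C^{1,alpha} on the sample space *)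

Section sample_hoelder.
Context {R : realType} {d : nat}.
Variable alpha : R.
Hypotheses (alpha_gt0 : 0 < alpha) (alpha_le1 : alpha <= 1).
Implicit Types (u v : sample R d -> R) (c : R).

(** The norm of a function of class C^{1,alpha} is at most [c]; a relation with
    explicit bounds is easier to compute with than the extended-real norm, which
    obeys the triangle inequality only at functions with partial derivatives. *)
Definition C1a_le u c : Prop := forall a y : bool, exists g b0 b1 b2,
  C1a_bound alpha (fun x => u (x, a, y)) g b0 b1 b2 /\
  b0 + \sum_i b1 i + \sum_i b2 i <= c.

Lemma C1a_leP u c : C1a_le u c <->
  (forall a y i x, has_partial i (fun x => u (x, a, y)) x) /\
  (sample_norm alpha u <= c%:E)%E.
Proof.
split=> [uc|[up uc] a y].
- split=> [a y|]; first exact: (iffLR (C1a_normP _ _ _) (uc a y)).1.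
  apply: ge_ereal_sup => _ [[a y] _ <-].
  exact: (iffLR (C1a_normP _ _ _) (uc a y)).2.
- apply/C1a_normP; split; first exact: up.
  by apply: le_trans uc; apply: ereal_sup_ubound; exists (a, y).
Qed.

Lemma in_C1aP u : in_C1a alpha u <-> exists c, C1a_le u c.
Proof.
split=> [[up]|[c /C1a_leP[up uc]]]; last first.
  by split => //; exact: le_lt_trans uc (ltry c).
case E : (sample_norm alpha u) => [c| |]// _.
- by exists c; apply/C1a_leP; rewrite E.
- by exists 0; apply/C1a_leP; rewrite E leNye.
Qed.

Lemma sample_norm_ge0 u : (0 <= sample_norm alpha u)%E.
Proof.
apply: le_ereal_sup_tmp; exists (C1a_norm alpha (fun x => u (x, true, true))).
  by exists (true, true).
exact: C1a_norm_ge0.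
Qed.

(** Convergence in norm, as it occurs in the notion of a C^1 curve, is thus turned
    into explicit bounds and back. *)
Lemma cvg_sample_norm (u_ : R -> sample R d -> R) (G : set_system R) {FG : Filter G} :
  (\forall s \near G, in_C1a alpha (u_ s)) ->
  sample_norm alpha (u_ s) @[s --> G] --> 0%E <->
  forall eps, 0 < eps -> \forall s \near G, C1a_le (u_ s) eps.
Proof.
move=> uC; split=> [/fine_cvgP[ufin /cvgrPdist_le u0] eps e0|u0].
- have := u0 _ e0; apply: filterS3 uC ufin => s [up _] usfin /=.
  rewrite sub0r normrN => us; apply/C1a_leP; split=> //.
  by rewrite -(fineK usfin) lee_fin (le_trans (ler_norm _)).
- apply/fine_cvgP; split.
    apply: filterS uC => s [_ uoo].
    by rewrite ge0_fin_numE ?sample_norm_ge0.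
  apply/cvgrPdist_le => eps e0; apply: filterS (u0 _ e0) => s /C1a_leP[_ us].
  rewrite sub0r normrN /= ger0_norm ?fine_ge0 ?sample_norm_ge0// -lee_fin fineK//.
  by rewrite ge0_fin_numE ?sample_norm_ge0//; exact: le_lt_trans us (ltry eps).
Qed.

Lemma C1a_leW u c c' : c <= c' -> C1a_le u c -> C1a_le u c'.
Proof.
move=> cc uc a y; have [g [b0 [b1 [b2 [ub bc]]]]] := uc a y.
by exists g, b0, b1, b2; split=> //; exact: le_trans cc.
Qed.

Lemma C1a_le_ge0 u c : C1a_le u c -> 0 <= c.
Proof.
move=> /(_ true true)[g [b0 [b1 [b2 [/C1a_bound_ge0[h0 h1 h2]]]]]].
by apply: le_trans; rewrite !addr_ge0// sumr_ge0.
Qed.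

Lemma C1a_le_abs u c o : C1a_le u c -> `|u o| <= c.
Proof.
case: o => -[x a] y /(_ a y)[g [b0 [b1 [b2 [ub bc]]]]].
have [h0 h1 h2] := C1a_bound_ge0 ub; case: ub => _ hb _ _ _.
apply: le_trans (hb x) _; apply: le_trans bc.
by rewrite -addrA lerDl addr_ge0// sumr_ge0.
Qed.

Lemma C1a_le_lipschitz u c x x' a y : C1a_le u c ->
  `|u (x, a, y) - u (x', a, y)| <= c * dist2 x x'.
Proof.
move=> /(_ a y)[g [b0 [b1 [b2 [ub bc]]]]].
have [h0 h1 h2] := C1a_bound_ge0 ub; case: ub => vg _ hb _ _.
apply: le_trans (grad_lipschitz x x' vg hb) _; rewrite ler_wpM2r ?dist2_ge0//.
by apply: le_trans bc; rewrite addrAC lerDr addr_ge0// sumr_ge0.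
Qed.

Lemma C1a_leD u v c c' : C1a_le u c -> C1a_le v c' -> C1a_le (u + v) (c + c').
Proof.
move=> uc vc a y; have [g [a0 [a1 [a2 [ub ac]]]]] := uc a y.
have [h [b0 [b1 [b2 [vb bc]]]]] := vc a y.
exists (fun i => g i + h i), (a0 + b0), (fun i => a1 i + b1 i), (fun i => a2 i + b2 i).
split; first exact: C1a_boundD.
apply: le_trans (lerD ac bc); rewrite !big_split/=.
by rewrite le_eqVlt; apply/orP; left; apply/eqP; ring.
Qed.

Lemma C1a_leZ (k : R) u c : C1a_le u c -> C1a_le (k *: u) (`|k| * c).
Proof.
move=> uc a y; have [g [a0 [a1 [a2 [ub ac]]]]] := uc a y.
exists (fun i => k *: g i), (`|k| * a0), (fun i => `|k| * a1 i), (fun i => `|k| * a2 i).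
split; first exact: C1a_boundZ.
by rewrite -!mulr_sumr -!mulrDr ler_wpM2l.
Qed.

Lemma C1a_leB u v c c' : C1a_le u c -> C1a_le v c' -> C1a_le (u - v) (c + c').
Proof.
by move=> uc /(@C1a_leZ (-1)); rewrite scaleN1r normrN1 mul1r; exact: C1a_leD.
Qed.

Lemma C1a_le0 : C1a_le 0 0.
Proof.
move=> a y; exists (fun _ _ => 0), 0, (fun=> 0), (fun=> 0).
split; last by rewrite !big1// !addr0.
split=> [i x|x|i x|i x x'|i]; rewrite ?subrr ?normr0 ?mul0r//.
rewrite /is_partial (_ : diff_quotient i _ x = fun=> 0); first exact: cvg_cst.
by apply/funext => t; rewrite /diff_quotient subrr mul0r.
Qed.

Lemma C1a_le_sum (I : Type) (r : seq I) (F : I -> sample R d -> R) (c : I -> R) :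
  (forall i, C1a_le (F i) (c i)) ->
  C1a_le (\sum_(i <- r) F i) (\sum_(i <- r) c i).
Proof.
move=> Fc; elim/big_rec2 : _ => [|i s t _]; first exact: C1a_le0.
exact: C1a_leD.
Qed.

(** Writing [A1], [B1] for the sums of the bounds of the partial derivatives, the
    bounds of [C1a_boundM] add up to at most the product of the two norms plus
    [2 * hoelder_diam * A1 * B1], and [A1 * B1] is at most that product again. *)
Lemma C1a_leM u v c c' : C1a_le u c -> C1a_le v c' ->
  C1a_le (u * v) ((1 + 2 * hoelder_diam (d := d) alpha) * (c * c')).
Proof.
move=> uc vc a y; have [g [a0 [a1 [a2 [ub ac]]]]] := uc a y.
have [h [b0 [b1 [b2 [vb bc]]]]] := vc a y.
exists (fun i x => g i x * v (x, a, y) + u (x, a, y) * h i x), (a0 * b0),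
  (fun i => a1 i * b0 + a0 * b1 i),
  (fun i => a2 i * b0 + a0 * b2 i + hoelder_diam (d := d) alpha *
    (a1 i * (\sum_j b1 j) + b1 i * (\sum_j a1 j))).
split; first exact: C1a_boundM.
have [a00 a10 a20] := C1a_bound_ge0 ub; have [b00 b10 b20] := C1a_bound_ge0 vb.
have D0 := @hoelder_diam_ge0 R d alpha.
rewrite !big_split/= -!mulr_sumr -!mulr_suml !big_split/= -!mulr_suml.
set A1 := \sum_i a1 i in ac *; set A2 := \sum_i a2 i in ac *.
set B1 := \sum_i b1 i in bc *; set B2 := \sum_i b2 i in bc *.
have A10 : 0 <= A1 by exact: sumr_ge0. have A20 : 0 <= A2 by exact: sumr_ge0.
have B10 : 0 <= B1 by exact: sumr_ge0. have B20 : 0 <= B2 by exact: sumr_ge0.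
set D := hoelder_diam alpha in D0 *.
have S0 : 0 <= a0 + A1 + A2 by rewrite !addr_ge0.
have T0 : 0 <= b0 + B1 + B2 by rewrite !addr_ge0.
apply: (@le_trans _ _ ((1 + 2 * D) * ((a0 + A1 + A2) * (b0 + B1 + B2)))).
  have p1 := mulr_ge0 A10 B20; have p2 := mulr_ge0 A20 B10.
  have p3 := mulr_ge0 A20 B20; have p4 := mulr_ge0 A10 B10.
  have AB : A1 * B1 <= (a0 + A1 + A2) * (b0 + B1 + B2).
    by apply: ler_pM => //; lra.
  have := ler_wpM2l D0 AB; nra.
by apply: ler_wpM2l; [lra|exact: ler_pM].
Qed.

(** The factor is crude, but completeness and Lipschitz estimates are not
    sensitive to constants. *)
Lemma C1a_le_components u c : 
  (forall a y, exists g, C1a_bound alpha (fun x => u (x, a, y)) g c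
     (fun=> c) (fun=> c)) -> C1a_le u ((1 + 2 * d%:R) * c).
Proof.
move=> uc a y; have [g gc] := uc a y; exists g, c, (fun=> c), (fun=> c).
by split=> //; rewrite sumr_const card_ord -mulr_natl; lra.
Qed.

Lemma C1a_le_bound u c a y g : C1a_le u c -> has_grad (fun x => u (x, a, y)) g ->
  C1a_bound alpha (fun x => u (x, a, y)) g c (fun=> c) (fun=> c).
Proof.
move=> uc ug; have [h [b0 [b1 [b2 [ub bc]]]]] := uc a y.
have [b00 b10 b20] := C1a_bound_ge0 ub; case: ub => uh h0 h1 h2 _.
have -> : g = h.
  apply/funext => i; apply/funext => x.
  by rewrite -(has_grad_partial i x ug) (has_grad_partial i x uh).
have S1 : 0 <= \sum_i b1 i by exact: sumr_ge0.
have S2 : 0 <= \sum_i b2 i by exact: sumr_ge0.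
have part (b : 'I_d -> R) i : (forall j, 0 <= b j) -> b i <= \sum_j b j.
  by move=> bp; rewrite (bigD1 i)//= lerDl sumr_ge0.
split=> [//|x|i x|i x x'|i].
- by apply: le_trans (h0 x) _; lra.
- by apply: le_trans (h1 i x) _; have := part _ i b10; lra.
- apply: le_trans (h2 i x x') _.
  by rewrite ler_wpM2r ?powR_ge0//; have := part _ i b20; lra.
- by rewrite (C1a_le_ge0 uc).
Qed.

Lemma C1a_le_closed u c : (forall eps, 0 < eps -> C1a_le u (c + eps)) -> C1a_le u c.
Proof.
move=> uc; apply/C1a_leP; split; first exact: (iffLR (C1a_leP _ _) (uc 1 ltr01)).1.
apply/lee_addgt0Pr => eps e0; rewrite -EFinD.
exact: (iffLR (C1a_leP _ _) (uc eps e0)).2.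
Qed.

Lemma cvg_dist_le (a_ : nat -> R) (l x e : R) : a_ n @[n --> \oo] --> l ->
  (exists N, forall n, (N <= n)%N -> `|x - a_ n| <= e) -> `|x - l| <= e.
Proof.
move=> al [N hN]; apply/ler_addgt0Pr => eps e0.
have [N' _ hN'] := iffLR (cvgrPdist_le a_ l) al _ e0.
have h1 := hN _ (leq_maxl N N'); have h2 := hN' (maxn N N') (leq_maxr _ _).
rewrite -(subrK (a_ (maxn N N')) x) -addrA (le_trans (ler_normD _ _))// lerD//.
by rewrite distrC.
Qed.

Lemma cauchy_seq_cvg (a_ : nat -> R) :
  (forall eps, 0 < eps -> exists N, forall m n, (N <= m)%N -> (N <= n)%N ->
     `|a_ m - a_ n| <= eps) ->
  a_ n @[n --> \oo] --> limn a_.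
Proof.
move=> ha; apply: cauchy_cvg; apply/cauchy_exP => eps e0.
have [N hN] := ha (eps / 2) (divr_gt0 e0 (ltr0Sn _ 1)).
exists (a_ N), N => // n /= Nn; rewrite /ball/=.
by apply: le_lt_trans (hN _ _ (leqnn N) Nn) _; lra.
Qed.

(** Completeness of C^{1,alpha}.  The functions and their partial derivatives
    converge uniformly; by the mean value theorem the difference quotients of
    [u_ m - u_ n] are bounded by the partial derivatives, so that the limit of
    the partial derivatives is the partial derivative of the limit. *)
Lemma C1a_complete (u_ : nat -> sample R d -> R) :
  (forall m, exists c, C1a_le (u_ m) c) ->
  (forall eps, 0 < eps -> exists N, forall m n, (N <= m)%N -> (N <= n)%N ->
     C1a_le (u_ m - u_ n) eps) ->
  exists u, forall eps, 0 < eps -> exists N, forall m, (N <= m)%N ->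
    C1a_le (u_ m - u) eps.
Proof.
move=> uC ucau.
pose v_ a y m x := u_ m (x, a, y).
pose g_ a y m i := partial i (v_ a y m).
have vg a y m : has_grad (v_ a y m) (g_ a y m).
  apply/has_partial_grad; have [c /C1a_leP[up _]] := uC m; exact: up.
pose v a y x := limn (fun m => v_ a y m x).
pose g a y i x := limn (fun m => g_ a y m i x).
have vgB a y m n : has_grad (v_ a y m - v_ a y n) (fun i => g_ a y m i - g_ a y n i).
  by move=> i x; exact: is_partialB (vg _ _ _ _ _) (vg _ _ _ _ _).
have bnd eps : 0 < eps -> exists N, forall a y m n, (N <= m)%N -> (N <= n)%N ->
    C1a_bound alpha (v_ a y m - v_ a y n) (fun i => g_ a y m i - g_ a y n i)
      eps (fun=> eps) (fun=> eps).
  move=> e0; have [N hN] := ucau _ e0; exists N => a y m n Nm Nn.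
  exact: C1a_le_bound (hN m n Nm Nn) (vgB a y m n).
have vcvg a y x : v_ a y m x @[m --> \oo] --> v a y x.
  apply: cauchy_seq_cvg => eps /bnd[N hN]; exists N => m n Nm Nn.
  by case: (hN a y m n Nm Nn) => _ /(_ x).
have gcvg a y i x : g_ a y m i x @[m --> \oo] --> g a y i x.
  apply: cauchy_seq_cvg => eps /bnd[N hN]; exists N => m n Nm Nn.
  by case: (hN a y m n Nm Nn) => _ _ /(_ i x).
have quot a y i x eps : 0 < eps -> exists N, forall m s, (N <= m)%N ->
    `|(v_ a y m (set_coord i x s) - v_ a y m x) -
      (v a y (set_coord i x s) - v a y x)| <= eps * `|(s : R) - (tnth x i : R)|.
  move=> /bnd[N hN]; exists N => m s Nm.
  apply: (@cvg_dist_le (fun n => v_ a y n (set_coord i x s) - v_ a y n x)).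
    exact: cvgB.
  exists N => n Nn; have [_ _ gB _ _] := hN a y m n Nm Nn.
  have := @partial_mean_value _ _ _ _ i x s 0 eps (vgB a y m n).
  rewrite mul0r subr0 !fctE => hq; apply: le_trans (hq _); last first.
    by move=> r _; rewrite subr0; exact: gB.
  by rewrite le_eqVlt; apply/orP; left; apply/eqP; congr `|_|; ring.
have vgrad a y : has_grad (v a y) (g a y).
  move=> i x; apply/is_partial_epsP => eps e0.
  have e3 : 0 < eps / 3 by lra.
  have [N1 hN1] := quot a y i x _ e3; have [N2 hN2] := bnd _ e3.
  pose m := maxn N1 N2.
  have gm : `|g_ a y m i x - g a y i x| <= eps / 3.
    apply: cvg_dist_le (gcvg a y i x) _; exists N2 => n Nn.
    by case: (hN2 a y m n (leq_maxr _ _) Nn) => _ _ /(_ i x).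
  have [e e_gt0 he] := iffLR (is_partial_epsP _ _ _ _) (vg a y m i x) _ e3.
  exists e => // s sx se; have hm := he s sx se.
  have sx0 : (s : R) - (tnth x i : R) != 0.
    by rewrite subr_eq0; apply: contra sx => /eqP/val_inj ->.
  have := hN1 m s (leq_maxl _ _); rewrite -ler_pdivrMr ?normr_gt0// -normf_div.
  rewrite mulrBl => hq.
  set q := (v a y _ - _) / _ in hq *; set qm := (v_ a y m _ - _) / _ in hm hq.
  have -> : q - g a y i x =
    - (qm - q) + (qm - g_ a y m i x) + (g_ a y m i x - g a y i x) by ring.
  apply: le_trans (ler_normD _ _) _.
  apply: le_trans (lerD (ler_normD _ _) (lexx _)) _; rewrite normrN; lra.
have exch (e1 e2 e3 e4 : R) : e1 - e2 - (e3 - e4) = e1 - e3 - (e2 - e4) by ring.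
exists (fun o => v o.1.2 o.2 o.1.1) => eps e0.
pose D : R := 1 + 2 * d%:R.
have D0 : 0 < D by rewrite ltr_wpDr// mulr_ge0.
have [N hN] := bnd (eps / D) (divr_gt0 e0 D0).
exists N => m Nm; rewrite -(divfK (lt0r_neq0 D0) eps) mulrC.
apply: C1a_le_components => a y; exists (fun i => g_ a y m i - g a y i).
split=> [i x|x|i x|i x x'|i].
- exact: is_partialB (vg _ _ _ _ _) (vgrad _ _ _ _).
- apply: cvg_dist_le (vcvg a y x) _; exists N => n Nn.
  by case: (hN a y m n Nm Nn) => _ /(_ x).
- apply: cvg_dist_le (gcvg a y i x) _; exists N => n Nn.
  by case: (hN a y m n Nm Nn) => _ _ /(_ i x).
- rewrite !fctE exch.
  apply: (@cvg_dist_le (fun n => g_ a y n i x - g_ a y n i x')); first exact: cvgB.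
  exists N => n Nn; case: (hN a y m n Nm Nn) => _ _ _ /(_ i x x') + _.
  by rewrite !fctE exch.
- by rewrite divr_ge0// ltW.
Qed.

End sample_hoelder.

(** * Integration over the sample space *)

Section sample_integral.
Context {R : realType} {d : nat}.
Implicit Types (u f g : sample R d -> R) (o : sample R d).
Local Notation mu := (sample_measure R d).

Lemma measurable_coord i :
  measurable_fun [set: sample R d] (fun o => (tnth o.1.1 i : R)).
Proof.
have mval : measurable_fun [set: unitI R] (fun s : unitI R => (s : R)).
  by move=> _ B mB; rewrite setTI; exists B => //; rewrite setTI.
apply: (measurableT_comp mval); apply: (measurableT_comp (measurable_tnth i)).
by apply: (measurableT_comp measurable_fst); exact: measurable_fst.
Qed.

Lemma measurable_countable_comp (I : countType) (phi : sample R d -> I) (h : I -> R) :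
  (forall i, measurable (phi @^-1` [set i])) ->
  measurable_fun [set: sample R d] (h \o phi).
Proof.
move=> mphi _ B mB; rewrite setTI.
have -> : (h \o phi) @^-1` B =
    \bigcup_(i in [set: I]) ((phi @^-1` [set i]) `&` [set _ | B (h i)]).
  apply/seteqP; split=> [z Bz|z [i _ [<- Bz]]] //.
  by exists (phi z).
apply: countable_bigcupT_measurable => // i.
apply: measurableI => //.
have [Bi|Bi] := pselect (B (h i)).
- by rewrite (_ : [set _ | _] = setT)//; apply/seteqP; split.
- by rewrite (_ : [set _ | _] = set0)//; apply/seteqP; split.
Qed.

(** The cells of the grid of mesh [1 / m] are measurable and countably many, so
    a function that is constant on the cells is measurable; a function that is
    Lipschitz in the cube variable is the limit of its values at the lower
    corners of the cells. *)
Lemma measurable_lipschitz u (L : R) :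
  (forall x x' a y, `|u (x, a, y) - u (x', a, y)| <= L * dist2 x x') ->
  measurable_fun [set: sample R d] u.
Proof.
move=> uL.
pose cell (m : nat) o : d.-tuple nat * bool * bool :=
  ([tuple Num.truncn (m.+1%:R * (tnth o.1.1 i : R)) | i < d], o.1.2, o.2).
pose corner (m : nat) (k : d.-tuple nat * bool * bool) : sample R d :=
  ([tuple toI ((tnth k.1.1 i)%:R / m.+1%:R) | i < d], k.1.2, k.2).
have mcell m k : measurable (cell m @^-1` [set k]).
  case: k => -[k a] y.
  have -> : cell m @^-1` [set (k, a, y)] =
      (\bigcap_(i in [set: 'I_d]) (fun o => (tnth o.1.1 i : R)) @^-1`
        [set s : R | (tnth k i)%:R / m.+1%:R <= s < (tnth k i).+1%:R / m.+1%:R]) `&`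
      ((fun o => o.1.2) @^-1` [set a] `&` snd @^-1` [set y]).
    apply/seteqP; split=> [[[x a'] y'] /= [<- <- <-]|[[x a'] y'] /= [hk [-> ->]]].
    - split=> // i _ /=; rewrite tnth_mktuple ler_pdivrMr// ltr_pdivlMr//.
      rewrite ![_ * m.+1%:R]mulrC truncn_itv// mulr_ge0//.
      by have /andP[] := unitI_itv (tnth x i).
    - congr (_, _, _); apply: eq_from_tnth => i; rewrite tnth_mktuple.
      have /andP[x0 _] := unitI_itv (tnth x i).
      have := hk i I; rewrite /= ler_pdivrMr// ltr_pdivlMr//.
      rewrite ![_ * m.+1%:R]mulrC -truncn_eq; first by move/eqP.
      exact: mulr_ge0.
  apply: measurableI; first apply: fin_bigcap_measurable => //.
  - move=> i _; rewrite -[X in measurable X]setTI; apply: measurable_coord => //.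
    have -> : [set s : R | (tnth k i)%:R / m.+1%:R <= s < (tnth k i).+1%:R / m.+1%:R]
        = `[(tnth k i)%:R / m.+1%:R, (tnth k i).+1%:R / m.+1%:R[%classic.
      by apply/seteqP; split=> s /=; rewrite in_itv.
    exact: measurable_itv.
  - apply: measurableI; rewrite -[X in measurable X]setTI.
    + exact: (measurableT_comp measurable_snd measurable_fst).
    + by apply: measurable_snd.
apply: (@measurable_fun_cvg _ _ _ _ (fun m => (u \o corner m) \o cell m)).
  by move=> m; apply: measurable_countable_comp.
move=> [[x a] y] _; apply/cvgrPdist_le => eps e0.
exists (Num.truncn (`|L| * d%:R / eps)) => // m /= Nm.
apply: le_trans (uL _ _ a y) _.
apply: (@le_trans _ _ (`|L| * (d%:R / m.+1%:R))); last first.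
  rewrite mulrA ler_pdivrMr// -ler_pdivrMl// mulrC.
  apply/ltW/(lt_le_trans (truncnS_gt _)).
  by rewrite ler_nat.
apply: le_trans (ler_wpM2r (dist2_ge0 _ _) (ler_norm L)) _.
apply: ler_wpM2l => //.
apply: le_trans (dist2_le_sum _ _) _.
rewrite -[d in X in _ <= X]card_ord mulr_natl -sumr_const; apply: ler_sum => i _.
rewrite !tnth_mktuple /=.
have x01 := unitI_itv (tnth x i); have /andP[x0 x1] := x01.
have mx0 : 0 <= m.+1%:R * (tnth x i : R) by exact: mulr_ge0.
have /andP[t1 t2] := truncn_itv mx0.
rewrite toI_val; last first.
  rewrite divr_ge0//= ler_pdivrMr// mul1r (le_trans t1)//.
  by rewrite -[X in _ <= X]mulr1 ler_wpM2l.
rewrite -(@ler_pM2l _ m.+1%:R)// -{1}(gtr0_norm (ltr0Sn R m)) -normrM mulrBr mulfV//.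
rewrite [_ * (_ / _)]mulrC divfK//; move: t2; rewrite -[(Num.truncn _).+1%:R]natr1 ler_norml; lra.
Qed.

Lemma sample_measure_fin : (mu [set: sample R d] < +oo)%E.
Proof.
have -> : mu [set: sample R d] = ((lebesgue_cube R d \x counting) \x counting)%E
    (([set: d.-tuple (unitI R)] `*` [set: bool]) `*` [set: bool]).
  by rewrite !setXTT.
have cT : (@counting bool R [set: bool] < +oo)%E.
  by rewrite -ge0_fin_numE//; exact: fin_num_measure.
have cubeT : (lebesgue_cube R d \x counting)%E
    ([set: d.-tuple (unitI R)] `*` [set: bool]) = counting [set: bool].
  by rewrite product_measure1E// [X in (X * _)%E]probability_setT mul1e.
rewrite product_measure1E//; last exact: measurableX.
by rewrite [X in (X * _)%E]cubeT lte_mul_pinfty// ge0_fin_numE.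
Qed.

Definition total_mass : R := fine (mu [set: sample R d]).

Lemma total_mass_ge0 : 0 <= total_mass.
Proof. exact: fine_ge0. Qed.

Lemma bounded_integrable f (c : R) : measurable_fun setT f ->
  (forall o, `|f o| <= c) -> mu.-integrable setT (EFin \o f).
Proof.
move=> mf fc; apply: measurable_bounded_integrable => //.
  exact: sample_measure_fin.
exists c; split; first exact: num_real.
by move=> e ce o _; apply: le_trans (ltW ce).
Qed.

Lemma Rintegral_bound f (c : R) : measurable_fun setT f ->
  (forall o, `|f o| <= c) -> `|\int[mu]_o f o| <= c * total_mass.
Proof.
move=> mf fc; apply: le_trans (le_normr_Rintegral _ _) _ => //.
  exact: bounded_integrable fc.
rewrite /total_mass -Rintegral_cst//; apply: le_Rintegral => //.
- by apply: (@bounded_integrable _ c) => [|o]; rewrite ?normr_id//;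
    exact: measurableT_comp.
- by apply: (@bounded_integrable _ `|c|).
Qed.

End sample_integral.

Section bounded_measurable.
Context {R : realType} {d : nat}.
Implicit Types (f g : sample R d -> R).
Local Notation mu := (sample_measure R d).

(** The measure is finite, so these functions are integrable; they are stable
    under products, which integrable functions are not. *)
Definition bounded_measurable f : Prop :=
  measurable_fun setT f /\ exists c : R, forall o, `|f o| <= c.

Lemma bm_integrable f : bounded_measurable f -> mu.-integrable setT (EFin \o f).
Proof. by case=> mf [c fc]; exact: bounded_integrable fc. Qed.

Lemma bmD f g : bounded_measurable f -> bounded_measurable g ->
  bounded_measurable (fun o => f o + g o).
Proof.
move=> [mf [c fc]] [mg [e ge_]]; split; first exact: measurable_funD.
by exists (c + e) => o; rewrite (le_trans (ler_normD _ _))// lerD.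
Qed.

Lemma bmM f g : bounded_measurable f -> bounded_measurable g ->
  bounded_measurable (fun o => f o * g o).
Proof.
move=> [mf [c fc]] [mg [e ge_]]; split; first exact: measurable_funM.
by exists (c * e) => o; rewrite normrM ler_pM.
Qed.

Lemma bm_cst (k : R) : bounded_measurable (fun=> k).
Proof. by split; [exact: measurable_cst|exists `|k|]. Qed.

Lemma bmZ (k : R) f : bounded_measurable f -> bounded_measurable (fun o => k * f o).
Proof. exact/bmM/bm_cst. Qed.

Lemma bmB f g : bounded_measurable f -> bounded_measurable g ->
  bounded_measurable (fun o => f o - g o).
Proof.
move=> bf /(bmZ (-1)) bg; have := bmD bf bg.
by rewrite (_ : (fun o => _ + _) = (fun o => f o - g o))//;
   apply/funext => o; rewrite mulN1r.
Qed.

Lemma bm_intD f g : bounded_measurable f -> bounded_measurable g ->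
  \int[mu]_o (f o + g o) = \int[mu]_o f o + \int[mu]_o g o.
Proof. by move=> bf bg; rewrite RintegralD//; exact: bm_integrable. Qed.

Lemma bm_intB f g : bounded_measurable f -> bounded_measurable g ->
  \int[mu]_o (f o - g o) = \int[mu]_o f o - \int[mu]_o g o.
Proof. by move=> bf bg; rewrite RintegralB//; exact: bm_integrable. Qed.

Lemma bm_intZ (k : R) f : bounded_measurable f ->
  \int[mu]_o (k * f o) = k * \int[mu]_o f o.
Proof. by move=> bf; rewrite RintegralZl//; exact: bm_integrable. Qed.

Lemma bm_int_le f g : bounded_measurable f -> bounded_measurable g ->
  (forall o, f o <= g o) -> \int[mu]_o f o <= \int[mu]_o g o.
Proof. by move=> bf bg fg; apply: le_Rintegral => //; exact: bm_integrable. Qed.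

Lemma bm_int_bound f (c : R) : bounded_measurable f ->
  (forall o, `|f o| <= c) -> `|\int[mu]_o f o| <= c * total_mass (R := R) (d := d).
Proof. by case=> mf _; exact: Rintegral_bound. Qed.

End bounded_measurable.

Section integral_with_parameter.
Context {R : realType} {d : nat}.
Variable alpha : R.
Hypotheses (alpha_gt0 : 0 < alpha) (alpha_le1 : alpha <= 1).
Local Notation mu := (sample_measure R d).

(** Differentiation under the integral sign.  By the mean value theorem the
    difference quotient of [k] in its first variable differs from the partial
    derivative by at most [c] times the power [alpha] of the increment,
    uniformly in the second variable, and this rate survives integration. *)
Lemma C1a_le_integral (k : sample R d -> sample R d -> R)
    (G : bool -> bool -> 'I_d -> d.-tuple (unitI R) -> sample R d -> R)
    (f : sample R d -> R) (c F : R) :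
  (forall a y o', C1a_bound alpha (fun x => k (x, a, y) o')
     (fun i x => G a y i x o') c (fun=> c) (fun=> c)) ->
  (forall o, measurable_fun setT (k o)) ->
  (forall a y i x, measurable_fun setT (G a y i x)) ->
  measurable_fun setT f -> (forall o, `|f o| <= F) ->
  C1a_le alpha (fun o => \int[mu]_o' (k o o' * f o'))
    ((1 + 2 * d%:R) * (c * F * total_mass (R := R) (d := d))).
Proof.
move=> kG mk mG mf fF; have Z0 := @total_mass_ge0 R d.
set Z := total_mass in Z0 *.
pose o0 : sample R d := ([tuple (toI 0) | _ < d], true, true).
have F0 : 0 <= F by exact: le_trans (fF o0).
have c0 : 0 <= c.
  by have [_ h _ _ _] := kG true true o0; exact: le_trans (h o0.1.1).
have bf : bounded_measurable f by split=> //; exists F.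
have bk o : bounded_measurable (k o).
  split=> //; exists c => o'; case: o => -[x a] y.
  by have [_ h _ _ _] := kG a y o'; exact: h.
have bG a y i x : bounded_measurable (G a y i x).
  by split=> //; exists c => o'; have [_ _ h _ _] := kG a y o'; exact: h.
apply: C1a_le_components => a y.
exists (fun i x => \int[mu]_o' (G a y i x o' * f o')).
split=> [i x|x|i x|i x x'|i].
- apply/is_partial_epsP => eps e0.
  pose B := c * F * Z + 1.
  have B0 : 0 < B by rewrite ltr_wpDl// !mulr_ge0.
  exists ((eps / B) `^ alpha^-1); first by rewrite powR_gt0 ?divr_gt0.
  move=> s sx se; set h := (s : R) - (tnth x i : R) in se *.
  have h0 : h != 0 by rewrite subr_eq0; apply: contra sx => /eqP/val_inj ->.
  have hB : `|h| `^ alpha <= eps / B.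
    apply: (@le_trans _ _ (((eps / B) `^ alpha^-1) `^ alpha)).
      by rewrite ge0_ler_powR ?nnegrE ?powR_ge0// ltW.
    by rewrite -powRrM mulVf ?gt_eqF// powRr1// divr_ge0// ltW.
  pose q o' := (k (set_coord i x s, a, y) o' - k (x, a, y) o') / h - G a y i x o'.
  have qE : \int[mu]_o' (q o' * f o') =
    (\int[mu]_o' (k (set_coord i x s, a, y) o' * f o') -
     \int[mu]_o' (k (x, a, y) o' * f o')) / h - \int[mu]_o' (G a y i x o' * f o').
    rewrite mulrC -bm_intB; [|exact: bmM..].
    rewrite -bm_intZ; last by apply: bmB; exact: bmM.
    rewrite -bm_intB; [|by apply: bmZ; apply: bmB; exact: bmM|exact: bmM].
    by apply: eq_Rintegral => o' _; rewrite /q; ring.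
  rewrite -qE.
  have qb o' : `|q o' * f o'| <= c * `|h| `^ alpha * F.
    rewrite normrM; apply: ler_pM => //.
    have [kg _ _ kh _] := kG a y o'.
    have := @partial_mean_value _ _ _ _ i x s (G a y i x o') (c * `|h| `^ alpha) kg.
    rewrite -/h => /(_ _) hm; rewrite /q -[G a y i x o'](mulfK h0) -mulrBl normrM.
    rewrite normfV ler_pdivrMr ?normr_gt0//; apply: hm => r rs.
    apply: le_trans (kh i _ x) _; rewrite dist2_set_coord ler_wpM2l//.
    by rewrite ge0_ler_powR ?nnegrE// ltW.
  apply: le_trans (bm_int_bound _ qb) _.
    by apply: bmM => //; apply: bmB => //;
       rewrite (_ : (fun o => _) = fun o => h^-1 * (k (set_coord i x s, a, y) o - k (x, a, y) o));
       [apply: bmZ; exact: bmB|apply/funext => o; rewrite mulrC].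
  rewrite -/Z.
  have -> : c * `|h| `^ alpha * F * Z = (c * F * Z) * `|h| `^ alpha by ring.
  apply: (@le_trans _ _ (B * (eps / B))); last by rewrite mulrC divfK ?gt_eqF.
  by rewrite ler_pM ?powR_ge0 ?mulr_ge0// /B lerDl.
- apply: bm_int_bound => [|o']; first exact: bmM.
  by rewrite normrM ler_pM//; have [_ h _ _ _] := kG a y o'; exact: h.
- apply: bm_int_bound => [|o']; first exact: bmM.
  by rewrite normrM ler_pM//; have [_ _ h _ _] := kG a y o'; exact: h.
- rewrite -bm_intB; [|exact: bmM..].
  have -> : c * F * Z * dist2 x x' `^ alpha = c * dist2 x x' `^ alpha * F * Z by ring.
  apply: bm_int_bound => [|o']; first by apply: bmB; exact: bmM.
  by rewrite -mulrBl normrM ler_pM//; have [_ _ _ h _] := kG a y o'; exact: h.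
- by rewrite !mulr_ge0.
Qed.

End integral_with_parameter.

(** * Geometry of a reproducing kernel Hilbert space *)

Section rkhs_geometry.
Context {R : realType} {T : Type}.
Variables (K : T -> T -> R) (H : set (T -> R)) (ip : (T -> R) -> (T -> R) -> R).
Hypothesis HK : is_rkhs K H ip.
Implicit Types (f g h : T -> R) (a : R).

Lemma rkhs_lin a f g : H f -> H g -> H (a *: f + g).
Proof. exact: rkhsP HK a f g. Qed.

Lemma rkhs_zero : H 0.
Proof. exact: rkhs0 HK. Qed.

Lemma rkhs_scale a f : H f -> H (a *: f).
Proof. by move=> Hf; rewrite -[_ *: _]addr0; exact: rkhs_lin Hf rkhs_zero. Qed.

Lemma rkhs_add f g : H f -> H g -> H (f + g).
Proof. by move=> Hf Hg; rewrite -[f]scale1r; exact: rkhs_lin. Qed.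

Lemma rkhs_sub f g : H f -> H g -> H (f - g).
Proof. by move=> Hf Hg; rewrite -scaleN1r addrC; exact: rkhs_lin. Qed.

Lemma ip_lin a f g h : H f -> H g -> H h ->
  ip (a *: f + g) h = a * ip f h + ip g h.
Proof. exact: rkhs_ipP HK a f g h. Qed.

Lemma ip_addl f g h : H f -> H g -> H h -> ip (f + g) h = ip f h + ip g h.
Proof. by move=> Hf Hg Hh; rewrite -{1}[f]scale1r ip_lin// mul1r. Qed.

Lemma ip_0l h : H h -> ip 0 h = 0.
Proof.
move=> Hh; have := ip_addl rkhs_zero rkhs_zero Hh.
by rewrite addr0 => /eqP; rewrite -subr_eq subrr => /eqP <-.
Qed.

Lemma ip_scalel a f h : H f -> H h -> ip (a *: f) h = a * ip f h.
Proof.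
move=> Hf Hh; rewrite -[_ *: _]addr0 ip_lin// ?ip_0l ?addr0//; exact: rkhs_zero.
Qed.

Lemma ip_subl f g h : H f -> H g -> H h -> ip (f - g) h = ip f h - ip g h.
Proof.
by move=> Hf Hg Hh; rewrite -scaleN1r addrC ip_lin// mulN1r addrC.
Qed.

Lemma ip_sqrD a f h : H f -> H h ->
  ip (f + a *: h) (f + a *: h) = ip f f + 2 * a * ip f h + a ^+ 2 * ip h h.
Proof.
move=> Hf Hh; have Hah := rkhs_scale a Hh; have Hs := rkhs_add Hf Hah.
rewrite ip_addl// ip_scalel// (rkhs_ipC HK Hf)// (rkhs_ipC HK Hh)//.
rewrite !ip_addl// !ip_scalel// (rkhs_ipC HK Hh Hf); ring.
Qed.

Lemma ip_cauchy_schwarz f h : H f -> H h -> ip f h ^+ 2 <= ip f f * ip h h.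
Proof.
move=> Hf Hh; have [h0|h0] := eqVneq (ip h h) 0.
  have -> : h = 0 by exact: rkhs_ip_eq0 HK h Hh h0.
  rewrite (rkhs_ipC HK Hf rkhs_zero) !ip_0l//; last exact: rkhs_zero.
  by rewrite mulr0 expr0n.
have hp : 0 < ip h h by rewrite lt_neqAle eq_sym h0 (rkhs_ip_ge0 HK).
have := rkhs_ip_ge0 HK (rkhs_add Hf (rkhs_scale (- (ip f h / ip h h)) Hh)).
rewrite ip_sqrD// => /(ler_wpM2r (ltW hp)); rewrite mul0r.
set A := ip f f; set B := ip f h; set D := ip h h in h0 hp *.
have -> : (A + 2 * - (B / D) * B + (- (B / D)) ^+ 2 * D) * D = A * D - B ^+ 2 by field.
by rewrite subr_ge0.
Qed.

Lemma rkhs_abs f x : H f -> f x ^+ 2 <= ip f f * K x x.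
Proof.
move=> Hf; have Hx := rkhs_kernel HK x.
rewrite {1}(rkhs_reproducing HK x Hf) (rkhs_reproducing HK x Hx).
exact: ip_cauchy_schwarz.
Qed.

Lemma rkhs_dist2 x y :
  ip (K x - K y) (K x - K y) = K x x - 2 * K x y + K y y.
Proof.
have Hx := rkhs_kernel HK x; have Hy := rkhs_kernel HK y.
have := ip_sqrD (-1) Hx Hy; rewrite scaleN1r => ->.
rewrite (rkhs_ipC HK Hx Hy) -!(rkhs_reproducing HK)// (rkhs_reproducing HK y Hx).
rewrite (rkhs_ipC HK Hx Hy) -(rkhs_reproducing HK)//; ring.
Qed.

(** A bounded linear functional [l] is represented by the minimizer of the
    energy [ip f f - 2 * l f].  The parallelogram identity makes minimizing
    sequences Cauchy, and their near-optimality against the perturbations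
    [f + t *: h] gives the Euler equation [ip f h = l h] in the limit. *)
Lemma rkhs_riesz (l : (T -> R) -> R) (B : R) :
  (forall a f g, H f -> H g -> l (a *: f + g) = a * l f + l g) ->
  (forall f, H f -> l f ^+ 2 <= B * ip f f) ->
  exists2 m, H m & forall f, H f -> ip f m = l f.
Proof.
move=> lin lB.
have B0 f : H f -> 0 <= B * ip f f by move=> /lB; exact: le_trans (sqr_ge0 _).
have lD f g : H f -> H g -> l (f + g) = l f + l g.
  by move=> Hf Hg; rewrite -{1}[f]scale1r lin// mul1r.
have l0 : l 0 = 0.
  have := lD _ _ rkhs_zero rkhs_zero.
  by rewrite addr0 => /eqP; rewrite -subr_eq subrr => /eqP <-.
have lZ a f : H f -> l (a *: f) = a * l f.
  by move=> Hf; rewrite -[_ *: _]addr0 lin// ?l0 ?addr0//; exact: rkhs_zero.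
pose J f := ip f f - 2 * l f.
pose S := [set J f | f in H].
have Sinf : has_inf S.
  split; first by exists (J 0), 0 => //; exact: rkhs_zero.
  exists (- `|B|) => _ [f Hf <-].
  have q0 := rkhs_ip_ge0 HK Hf.
  have lB' : l f ^+ 2 <= `|B| * ip f f.
    by apply: le_trans (lB _ Hf) _; rewrite ler_wpM2r// ler_norm.
  suff : 2 * l f <= ip f f + `|B| by rewrite /J; lra.
  have s0 : 0 <= ip f f + `|B| by exact: addr_ge0.
  have [lf|lf] := leP (l f) 0; first by apply: le_trans s0; lra.
  rewrite -(@ler_pXn2r _ 2) ?nnegrE//; last by lra.
  have := sqr_ge0 (ip f f - `|B|); nra.
pose I := inf S.
have JI f : H f -> I <= J f by move=> Hf; apply: ge_inf; [exact: Sinf.2|exists f].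
have /choice[f_ f_P] : forall n : nat, exists f, H f /\ J f <= I + n.+1%:R^-1.
  move=> n; have n0 : 0 < n.+1%:R^-1 :> R by rewrite invr_gt0.
  by have [_ [f Hf <-] /ltW Jf] := inf_adherent n0 Sinf; exists f.
have Hf_ n : H (f_ n) by case: (f_P n).
have Jf_ n : J (f_ n) <= I + n.+1%:R^-1 by case: (f_P n).
have cau m n : ip (f_ m \- f_ n) (f_ m \- f_ n) <= 2 * (m.+1%:R^-1 + n.+1%:R^-1).
  have Hs : H (f_ m + f_ n) by exact: rkhs_add.
  have := JI _ (rkhs_scale (2^-1) Hs).
  have := Jf_ m; have := Jf_ n; rewrite /J lZ// lD//.
  rewrite -[2^-1 *: _]add0r ip_sqrD//; last exact: rkhs_zero.
  rewrite !ip_0l//; last exact: rkhs_zero.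
  have := ip_sqrD 1 (Hf_ m) (Hf_ n); rewrite scale1r => ->.
  have -> : ip (f_ m \- f_ n) (f_ m \- f_ n) =
    ip (f_ m) (f_ m) + 2 * (-1) * ip (f_ m) (f_ n) + (-1) ^+ 2 * ip (f_ n) (f_ n).
    by rewrite -ip_sqrD// scaleN1r.
  set em := m.+1%:R^-1; set en := n.+1%:R^-1.
  have -> : 2^-1 ^+ 2 = 4^-1 :> R by rewrite exprVn -natrX.
  rewrite sqrrN !expr1n; lra.
have small (eps : R) : 0 < eps -> exists N, forall n, (N <= n)%N -> n.+1%:R^-1 <= eps.
  move=> e0; exists (Num.truncn eps^-1) => n Nn.
  rewrite -[leRHS]invrK lef_pV2 ?posrE ?invr_gt0//.
  by apply/ltW/(lt_le_trans (truncnS_gt _)); rewrite ler_nat.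
have [|m Hm fm] := rkhs_complete HK Hf_.
  move=> eps e0; have [N hN] := small (eps / 4) (divr_gt0 e0 (ltr0Sn _ 3)).
  exists N => m n Nm Nn; apply: le_trans (cau m n) _.
  by have := lerD (hN _ Nm) (hN _ Nn); set s := _ + _; lra.
exists m => // h Hh; rewrite (rkhs_ipC HK)//; apply/eqP; rewrite -subr_eq0 -normr_le0.
have q0 := rkhs_ip_ge0 HK Hh; set q := ip h h in q0.
have rn n : (ip (f_ n) h - l h) ^+ 2 <= q * n.+1%:R^-1.
  set r := ip _ _ - _.
  have tb t : - n.+1%:R^-1 <= 2 * t * r + t ^+ 2 * q.
    have := JI _ (rkhs_add (Hf_ n) (rkhs_scale t Hh)).
    have := Jf_ n; rewrite /J ip_sqrD// lD ?lZ//; last exact: rkhs_scale.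
    by rewrite /r -/q; set en := n.+1%:R^-1; lra.
  have [qz|qz] := eqVneq q 0.
    have hz : h = 0 by exact: rkhs_ip_eq0 HK h Hh qz.
    by rewrite /r hz l0 (rkhs_ipC HK (Hf_ n) rkhs_zero) ip_0l// subrr expr0n mulr_ge0.
  have qp : 0 < q by rewrite lt_neqAle eq_sym qz.
  have := ler_wpM2r (ltW qp) (tb (- (r / q))).
  have -> : (2 * - (r / q) * r + (- (r / q)) ^+ 2 * q) * q = - r ^+ 2 by field.
  by rewrite mulNr lerN2 mulrC.
apply/ler_addgt0Pr => eps e0; rewrite add0r.
pose e2 := (eps / 2) ^+ 2 / (q + 1).
have e20 : 0 < e2 by rewrite divr_gt0 ?exprn_gt0 ?divr_gt0// ltr_wpDl.
have [N1 hN1] := small _ e20.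
have [N2 _ hN2] := iffLR (cvgrPdist_le _ _) fm _ e20.
pose n := maxn N1 N2.
have qe2 : q * e2 <= (eps / 2) ^+ 2.
  rewrite /e2 mulrCA ger_pMr ?exprn_gt0 ?divr_gt0//.
  by rewrite ler_pdivrMr ?ltr_wpDl// mul1r; lra.
have b1 : `|ip (f_ n) h - l h| <= eps / 2.
  rewrite -(@ler_pXn2r _ 2) ?nnegrE// ?real_normK ?num_real//; last by lra.
  by apply: le_trans (rn n) _; apply: le_trans qe2; rewrite ler_wpM2l// hN1// leq_maxl.
have b2 : `|ip (f_ n) h - ip m h| <= eps / 2.
  rewrite -ip_subl//.
  rewrite -(@ler_pXn2r _ 2) ?nnegrE// ?real_normK ?num_real//; last by lra.
  apply: le_trans (ip_cauchy_schwarz (rkhs_sub (Hf_ n) Hm) Hh) _.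
  apply: le_trans qe2; rewrite mulrC ler_wpM2l//.
  by have := hN2 n (leq_maxr _ _); rewrite sub0r normrN; apply: le_trans; exact: ler_norm.
have -> : ip m h - l h = (ip (f_ n) h - l h) - (ip (f_ n) h - ip m h) by ring.
by apply: le_trans (ler_normB _ _) _; lra.
Qed.

End rkhs_geometry.

(** * The Gaussian kernel *)

Section gauss_kernel_facts.
Context {R : realType} {d : nat}.
Variable sigma : R.
Hypothesis sigma_gt0 : 0 < sigma.
Implicit Types (o : sample R d).
Local Notation K := (@gauss_kernel R d sigma).

Lemma sample_dist_sqr o o' : sample_dist o o' ^+ 2 =
  \sum_(i < d) ((tnth o.1.1 i : R) - (tnth o'.1.1 i : R)) ^+ 2
  + ((o.1.2)%:R - (o'.1.2)%:R) ^+ 2 + ((o.2)%:R - (o'.2)%:R) ^+ 2.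
Proof.
rewrite sqr_sqrtr ?dist2_sqr// !addr_ge0 ?sqr_ge0//.
by apply: sumr_ge0 => i _; rewrite sqr_ge0.
Qed.

Lemma gauss_kernelC o o' : K o o' = K o' o.
Proof.
have C (a b : R) : (a - b) ^+ 2 = (b - a) ^+ 2 by rewrite -sqrrN opprB.
rewrite /gauss_kernel (_ : sample_dist o o' ^+ 2 = sample_dist o' o ^+ 2)//.
rewrite !sample_dist_sqr (C o.1.2%:R) (C o.2%:R).
by rewrite (eq_bigr _ (fun i _ => C (tnth o.1.1 i) (tnth o'.1.1 i))).
Qed.

Lemma gauss_kernel_diag o : K o o = 1.
Proof.
rewrite /gauss_kernel sample_dist_sqr !subrr !expr0n !addr0 big1 ?mul0r ?oppr0 ?expR0//.
by move=> i _; rewrite subrr expr0n.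
Qed.

Lemma gauss_kernel_le1 o o' : K o o' <= 1.
Proof.
by rewrite -expR0 ler_expR oppr_le0 divr_ge0 ?sqr_ge0// mulr_ge0// sqr_ge0.
Qed.

(** The squared distance of two points of the sample space is at most [d + 2]. *)
Definition gauss_lower : R := expR (- ((d%:R + 2) / (2 * sigma ^+ 2))).

Lemma gauss_lower_gt0 : 0 < gauss_lower.
Proof. exact: expR_gt0. Qed.

Lemma gauss_kernel_ge o o' : gauss_lower <= K o o'.
Proof.
rewrite ler_expR lerN2; apply: ler_wpM2r.
  by rewrite invr_ge0 mulr_ge0// sqr_ge0.
rewrite sample_dist_sqr.
have b1 (b b' : bool) : ((b%:R : R) - b'%:R) ^+ 2 <= 1.
  by case: b b' => [] []; rewrite ?subrr ?subr0 ?sub0r ?sqrrN ?expr0n ?expr1n.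
have := b1 o.1.2 o'.1.2; have := b1 o.2 o'.2.
suff : \sum_(i < d) ((tnth o.1.1 i : R) - (tnth o'.1.1 i : R)) ^+ 2 <= d%:R by lra.
rewrite -[X in _ <= X%:R]card_ord -sum1_card natr_sum.
apply: ler_sum => i _; rewrite -real_normK ?num_real// expr_le1//.
have := unitI_itv (tnth o.1.1 i); have := unitI_itv (tnth o'.1.1 i).
by rewrite ler_norml; lra.
Qed.

Lemma gauss_kernel_gt0 o o' : 0 < K o o'.
Proof. exact: expR_gt0. Qed.

Lemma gauss_kernel_abs o o' : `|K o o'| <= 1.
Proof. by rewrite gtr0_norm ?gauss_kernel_gt0// gauss_kernel_le1. Qed.

(** The convexity inequality [1 - t <= exp (- t)]. *)
Lemma gauss_kernel_slice x x' a y :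
  1 - K (x, a, y) (x', a, y) <= dist2 x x' ^+ 2 / (2 * sigma ^+ 2).
Proof.
rewrite /gauss_kernel sample_dist_sqr !subrr /= !expr0n !addr0 -dist2_sqr.
by have := expR_ge1Dx (- (dist2 x x' ^+ 2 / (2 * sigma ^+ 2))); lra.
Qed.

Lemma measurable_gauss_kernel o : measurable_fun setT (K o).
Proof.
rewrite /gauss_kernel; apply: measurableT_comp => //.
apply: measurableT_comp => //; apply: measurable_funM => //.
rewrite (_ : (fun o' => _) = fun o' => sample_dist o o' ^+ 2)//.
have -> : (fun o' => sample_dist o o' ^+ 2) = (fun o' =>
    \sum_(i < d) ((tnth o.1.1 i : R) - (tnth o'.1.1 i : R)) ^+ 2
    + ((o.1.2)%:R - (o'.1.2)%:R) ^+ 2 + ((o.2)%:R - (o'.2)%:R) ^+ 2).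
  by apply/funext => o'; exact: sample_dist_sqr.
have mb : measurable_fun [set: bool] (fun b : bool => b%:R : R) by [].
apply: measurable_funD; first apply: measurable_funD.
- apply: measurable_sum => i; apply: measurable_funX; apply: measurable_funB => //.
  exact: measurable_coord.
- apply: measurable_funX; apply: measurable_funB => //.
  apply: (measurableT_comp mb).
  exact: (measurableT_comp measurable_snd measurable_fst).
- apply: measurable_funX; apply: measurable_funB => //.
  by apply: (measurableT_comp mb); exact: measurable_snd.
Qed.

Definition gauss_grad (a y : bool) (i : 'I_d) (x : d.-tuple (unitI R)) o' : R :=
  - (((tnth x i : R) - (tnth o'.1.1 i : R)) / sigma ^+ 2) * K (x, a, y) o'.

Lemma measurable_gauss_grad a y i x : measurable_fun setT (gauss_grad a y i x).
Proof.
apply: measurable_funM; last exact: measurable_gauss_kernel.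
apply: measurableT_comp => //; apply: measurable_funM => //.
by apply: measurable_funB => //; exact: measurable_coord.
Qed.

Lemma is_partial_derive (v : d.-tuple (unitI R) -> R) i x (phi : R -> R) (l : R) :
  (forall s : unitI R, v (set_coord i x s) = phi s) ->
  is_derive (tnth x i : R) (1 : R) phi l -> is_partial i v x l.
Proof.
move=> vphi [dphi lE]; apply/is_partial_epsP => eps e0.
have xphi : v x = phi (tnth x i) by rewrite -vphi set_coord_id.
move: dphi; rewrite /derivable => /cvg_ex[l' /= hl'].
have l'E : l' = l by rewrite -lE; apply/esym/cvg_lim.
move: hl'; rewrite l'E => /cvgrPdist_le/(_ _ e0)/nbhs_ballP[r /= r0 hr].
exists (r / 2); first by lra.
move=> s sx sr; have h0 : (s : R) - (tnth x i : R) != 0.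
  by rewrite subr_eq0; apply: contra sx => /eqP/val_inj ->.
have sr' : `|(s : R) - (tnth x i : R)| < r by apply: le_lt_trans sr _; lra.
have := hr ((s : R) - (tnth x i : R)); rewrite /ball/= sub0r normrN => /(_ sr' h0).
by rewrite distrC vphi xphi [_%:A]mulr1 subrK mulrC.
Qed.

(** Along a coordinate axis the kernel is the exponential of a polynomial. *)
Lemma gauss_kernel_grad a y o' :
  has_grad (fun x => K (x, a, y) o') (fun i x => gauss_grad a y i x o').
Proof.
move=> i x; pose t : R := tnth x i; pose t' : R := tnth o'.1.1 i.
pose rest := \sum_(j < d | j != i) ((tnth x j : R) - (tnth o'.1.1 j : R)) ^+ 2
  + (a%:R - (o'.1.2)%:R) ^+ 2 + (y%:R - (o'.2)%:R) ^+ 2.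
pose phi (s : R) := expR (- (((s - t') ^+ 2 + rest) / (2 * sigma ^+ 2))).
have phiE (s : unitI R) : K (set_coord i x s, a, y) o' = phi s.
  rewrite /gauss_kernel sample_dist_sqr (bigD1 i)//= tnth_set_coord.
  rewrite (eq_bigr (fun j => ((tnth x j : R) - (tnth o'.1.1 j : R)) ^+ 2)).
    by rewrite /phi /rest -!addrA.
  by move=> j ji; rewrite tnth_mktuple (negPf ji).
apply: (is_partial_derive phiE).
pose P : {poly R} := (- (2 * sigma ^+ 2)^-1) *: (('X - t'%:P) * ('X - t'%:P) + rest%:P).
have sigma0 : sigma != 0 by rewrite gt_eqF.
have PE (s : R) : P.[s] = - (((s - t') ^+ 2 + rest) / (2 * sigma ^+ 2)).
  by rewrite /P hornerZ hornerD hornerM hornerXsubC hornerC -expr2 mulrC mulrN.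
have dP : P^`().[t] = - ((t - t') / sigma ^+ 2).
  rewrite /P derivZ derivD derivC addr0 derivM derivXsubC mul1r mulr1.
  by rewrite hornerZ hornerD hornerXsubC; field.
have -> : gauss_grad a y i x o' = expR P.[t] * P^`().[t].
  by rewrite /gauss_grad dP mulrC -[in K _ _](set_coord_id i x) phiE PE.
have -> : phi = expR \o horner P by apply/funext => s; rewrite /= PE.
exact: (is_derive1_comp (f := expR) (g := horner P)).
Qed.

End gauss_kernel_facts.

(** * Centered sections through the mean embedding *)

Section centered_sections.
Context {R : realType} {d : nat}.
Variables (sigma : R) (H : set (sample R d -> R))
  (ip : (sample R d -> R) -> (sample R d -> R) -> R).
Hypothesis sigma_gt0 : 0 < sigma.
Local Notation K := (@gauss_kernel R d sigma).
Local Notation mu := (sample_measure R d).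
Hypothesis HK : is_rkhs K H ip.
Implicit Types (o : sample R d) (f p : sample R d -> R).

Definition is_density p : Prop :=
  [/\ bounded_measurable p, forall o, 0 <= p o & \int[mu]_o p o = 1].

Lemma expect_ge p f (c : R) : is_density p -> bounded_measurable f ->
  (forall o, c <= f o) -> c <= expect p f.
Proof.
move=> [bp p0 p1] bf cf; rewrite -[c]mulr1 -p1 -bm_intZ//.
by apply: bm_int_le => [||o]; [exact: bmZ|exact: bmM|rewrite ler_wpM2r].
Qed.

Lemma expect_abs p f (c : R) : is_density p -> bounded_measurable f ->
  (forall o, `|f o| <= c) -> `|expect p f| <= c.
Proof.
move=> pd bf fc; have [bp p0 p1] := pd.
rewrite ler_norml; apply/andP; split.
  by apply: expect_ge => // o; have := fc o; rewrite ler_norml => /andP[].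
rewrite -lerN2; have -> : - expect p f = expect p (fun o => -1 * f o).
  rewrite /expect -[LHS]mulN1r -bm_intZ; last exact: bmM.
  by apply: eq_Rintegral => o _; rewrite mulrA.
apply: expect_ge => // [|o]; first exact: bmZ.
by have := fc o; rewrite ler_norml mulN1r lerN2 => /andP[].
Qed.

Lemma expect_lin p (a : R) f g : is_density p -> bounded_measurable f ->
  bounded_measurable g -> expect p (a *: f + g) = a * expect p f + expect p g.
Proof.
move=> [bp _ _] bf bg; rewrite /expect -bm_intZ; last exact: bmM.
rewrite -bm_intD; [|by apply: bmZ; exact: bmM|exact: bmM].
by apply: eq_Rintegral => o _; rewrite mulrA -mulrDl.
Qed.

Lemma gauss_kernel_bm o : bounded_measurable (K o).
Proof.
split; first exact: measurable_gauss_kernel.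
by exists 1 => o'; exact: gauss_kernel_abs.
Qed.

Lemma rkhs_gauss_abs f o : H f -> `|f o| <= Num.sqrt (ip f f).
Proof.
move=> Hf; rewrite -sqrtr_sqr ler_wsqrtr//.
by have := rkhs_abs HK o Hf; rewrite gauss_kernel_diag mulr1.
Qed.

(** Members of the reproducing kernel Hilbert space are Lipschitz along each
    slice, because [1 - K o o'] is half the squared distance of the sections
    [K o] and [K o']; this is what makes them measurable. *)
Lemma rkhs_gauss_bm f : H f -> bounded_measurable f.
Proof.
move=> Hf; split; last by exists (Num.sqrt (ip f f)) => o; exact: rkhs_gauss_abs.
pose L := Num.sqrt (ip f f * sigma ^- 2).
apply: (@measurable_lipschitz _ _ f L) => x x' a y.
set o := (x, a, y); set o' := (x', a, y).
have Ho := rkhs_kernel HK o; have Ho' := rkhs_kernel HK o'.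
have q0 := rkhs_ip_ge0 HK Hf.
rewrite (rkhs_reproducing HK o Hf) (rkhs_reproducing HK o' Hf).
rewrite !(rkhs_ipC HK Hf)// -(ip_subl HK)// -sqrtr_sqr.
rewrite -[dist2 _ _]ger0_norm ?dist2_ge0// -sqrtr_sqr -sqrtrM; last first.
  by rewrite mulr_ge0// invr_ge0 sqr_ge0.
rewrite ler_wsqrtr//.
apply: le_trans (ip_cauchy_schwarz HK (rkhs_sub HK Ho Ho') Hf) _.
have -> : ip (K o - K o') (K o - K o') = 2 * (1 - K o o').
  rewrite (rkhs_dist2 HK) (gauss_kernel_diag _ o) (gauss_kernel_diag _ o').
  by move: (K o o') => b; ring.
rewrite mulrC -mulrA; apply: ler_wpM2l => //.
have := gauss_kernel_slice sigma x x' a y; rewrite -/o -/o'.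
have -> : sigma ^- 2 * dist2 x x' ^+ 2 = 2 * (dist2 x x' ^+ 2 / (2 * sigma ^+ 2)).
  by field; rewrite gt_eqF.
lra.
Qed.

Definition mean_embedding p o : R := expect p (K o).

(** The squared norm of the mean embedding, which represents the expectation. *)
Definition embedding_norm2 p : R := expect p (mean_embedding p).

(** The mean embedding represents the expectation in the reproducing kernel
    Hilbert space: the Riesz representer [m] of the expectation satisfies
    [m o = ip m (K o) = expect p (K o)]. *)
Lemma mean_embedding_rkhs p : is_density p ->
  H (mean_embedding p) /\ forall f, H f -> ip f (mean_embedding p) = expect p f.
Proof.
move=> pd; have [|f Hf|m Hm mP] := @rkhs_riesz _ _ _ _ _ HK (expect p) 1.
- by move=> a f g Hf Hg; apply: expect_lin => //; exact: rkhs_gauss_bm.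
- have := expect_abs pd (rkhs_gauss_bm Hf) (fun o => rkhs_gauss_abs o Hf).
  have q0 := rkhs_ip_ge0 HK Hf => h.
  rewrite mul1r -real_normK ?num_real// -[leRHS](sqr_sqrtr q0).
  by rewrite ler_pXn2r// nnegrE sqrtr_ge0.
suff -> : mean_embedding p = m by [].
apply/funext => o; have Ho := rkhs_kernel HK o.
by rewrite /mean_embedding -mP// (rkhs_ipC HK)// -(rkhs_reproducing HK).
Qed.

Lemma mean_embedding_ge p o : is_density p -> gauss_lower (d := d) sigma <= mean_embedding p o.
Proof.
by move=> pd; apply: expect_ge => // [|o']; [exact: gauss_kernel_bm|exact: gauss_kernel_ge].
Qed.

Lemma mean_embedding_bm p : is_density p -> bounded_measurable (mean_embedding p).
Proof. by move=> pd; apply: rkhs_gauss_bm; exact: (mean_embedding_rkhs pd).1. Qed.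

Lemma embedding_norm2_ge p : is_density p -> gauss_lower (d := d) sigma <= embedding_norm2 p.
Proof.
move=> pd; apply: expect_ge => // [|o]; first exact: mean_embedding_bm.
exact: mean_embedding_ge.
Qed.

Lemma embedding_norm2_gt0 p : is_density p -> 0 < embedding_norm2 p.
Proof. by move=> /embedding_norm2_ge; apply: lt_le_trans; exact: gauss_lower_gt0. Qed.

Lemma centered_section_spec p o : is_density p ->
  let g := K o - (mean_embedding p o / embedding_norm2 p) *: mean_embedding p in
  rkhs_centered H p g /\ forall h, rkhs_centered H p h -> ip (K o \- g) h = 0.
Proof.
move=> pd g; have [Hm mP] := mean_embedding_rkhs pd.
have N0 := embedding_norm2_gt0 pd; have Ho := rkhs_kernel HK o.
have Hg : H g by apply: (rkhs_sub HK) => //; exact: (rkhs_scale HK).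
split.
  split=> //; rewrite -mP// /g (ip_subl HK)//; last exact: (rkhs_scale HK).
  rewrite (ip_scalel HK)// !mP// -/(embedding_norm2 p) -/(mean_embedding p o).
  by rewrite divfK ?subrr// gt_eqF.
move=> h [Hh h0].
have -> : K o \- g = (mean_embedding p o / embedding_norm2 p) *: mean_embedding p.
  by apply/funext => z; rewrite /g /= !fctE; ring.
by rewrite (ip_scalel HK)// (rkhs_ipC HK)// mP// h0 mulr0.
Qed.

(** The centered functions are the orthogonal complement of the mean embedding,
    so centering a section removes its component along the mean embedding. *)
Lemma centered_sectionE p o : is_density p -> centered_section K H ip p o =
  K o - (mean_embedding p o / embedding_norm2 p) *: mean_embedding p.
Proof.
move=> pd; have [gV gO] := centered_section_spec o pd.
set g := K o - _ in gV gO *.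
apply: xget_unique; first by split.
move=> h [hV hO]; have Hg := gV.1; have Hh := hV.1; have Ho := rkhs_kernel HK o.
have Hgh := rkhs_sub HK Hg Hh.
have V : rkhs_centered H p (h - g).
  split; first exact: (rkhs_sub HK).
  have [_ mP] := mean_embedding_rkhs pd.
  rewrite -mP; last exact: (rkhs_sub HK).
  have Hm := (mean_embedding_rkhs pd).1.
  by rewrite (ip_subl HK)// !mP// hV.2 gV.2 subrr.
apply/eqP; rewrite -subr_eq0; apply/eqP.
apply: (rkhs_ip_eq0 HK V.1).
have e : h - g = (K o \- g) - (K o \- h).
  by apply/funext => z; rewrite !fctE /=; move: (K o z) => b; ring.
have H1 : H (K o \- g) by exact: (rkhs_sub HK).
have H2 : H (K o \- h) by exact: (rkhs_sub HK).
by rewrite {1}e (ip_subl HK) ?gO ?hO ?subrr//; exact: V.1.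
Qed.

Lemma expect_centered p o : is_density p -> expect p (centered_section K H ip p o) = 0.
Proof.
by move=> pd; rewrite centered_sectionE//; have [[]] := centered_section_spec o pd.
Qed.

Lemma centered_kernelE p o o' : is_density p -> centered_kernel K H ip p o o' =
  K o o' - mean_embedding p o * mean_embedding p o' / embedding_norm2 p.
Proof.
move=> pd; rewrite /centered_kernel; have [[Hg g0] gO] := centered_section_spec o pd.
rewrite centered_sectionE//; set g := K o - _ in Hg g0 gO *.
have [[Hg' g0'] _] := centered_section_spec o' pd.
have [Hm mP] := mean_embedding_rkhs pd.
rewrite centered_sectionE// (rkhs_ipC HK)// (ip_subl HK)//; last 2 first.
- exact: (rkhs_kernel HK).
- exact: (rkhs_scale HK).
rewrite (ip_scalel HK)// [ip _ g](rkhs_ipC HK)//; last exact: (rkhs_kernel HK).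
rewrite -(rkhs_reproducing HK)// (rkhs_ipC HK Hm)// mP// g0 mulr0 subr0.
have -> : g o' = K o o' - mean_embedding p o / embedding_norm2 p * mean_embedding p o' by [].
by rewrite mulrAC.
Qed.

(** Centering is an orthogonal projection, hence contracts the sections of the
    kernel, which have norm 1; the bound is the Cauchy-Schwarz inequality. *)
Lemma centered_kernel_abs p o o' : is_density p -> `|centered_kernel K H ip p o o'| <= 1.
Proof.
move=> pd; have N0 := embedding_norm2_gt0 pd.
have Hc z : H (centered_section K H ip p z).
  by rewrite centered_sectionE//; have [[]] := centered_section_spec z pd.
have self z : ip (centered_section K H ip p z) (centered_section K H ip p z) <= 1.
  rewrite -/(centered_kernel K H ip p z z) centered_kernelE// gauss_kernel_diag.
  by rewrite lerBlDr lerDl divr_ge0 ?(ltW N0)// -expr2 sqr_ge0.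
rewrite -(@ler_pXn2r _ 2) ?nnegrE// real_normK ?num_real// expr1n.
apply: le_trans (ip_cauchy_schwarz HK (Hc o) (Hc o')) _.
by rewrite mulr_ile1 ?(rkhs_ip_ge0 HK).
Qed.

End centered_sections.

(** * Lipschitz dependence on the density *)

Section lipschitz_calculus.
Context {R : realType} {d : nat}.
Variable alpha : R.
Hypotheses (alpha_gt0 : 0 < alpha) (alpha_le1 : alpha <= 1).
Variable B : set (sample R d -> R).
Implicit Types (a b : (sample R d -> R) -> R) (v w : (sample R d -> R) -> sample R d -> R).

Definition close_to (p q : sample R d -> R) (e : R) : Prop := forall o, `|p o - q o| <= e.

Lemma close_to_ge0 p q e : close_to p q e -> 0 <= e.
Proof. by move=> /(_ ([tuple (toI 0) | _ < d], true, true)); exact: le_trans. Qed.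

Definition lip_num a : Prop := exists2 L, 0 <= L &
  (forall p, B p -> `|a p| <= L) /\
  (forall p q e, B p -> B q -> close_to p q e -> `|a p - a q| <= L * e).

(** The source carries the supremum distance and the target the norm of
    C^{1,alpha}: the data of the problem depend on a density through integrals
    against smooth functions only. *)
Definition lip_fun v : Prop := exists2 L, 0 <= L &
  (forall p, B p -> C1a_le alpha (v p) L) /\
  (forall p q e, B p -> B q -> close_to p q e -> C1a_le alpha (v p - v q) (L * e)).

Lemma eq_lip_fun v w : (forall p, B p -> v p = w p) -> lip_fun v -> lip_fun w.
Proof.
move=> vw [L L0 [vL vlip]]; exists L => //; split=> [p Bp|p q e Bp Bq pq].
  by rewrite -vw//; exact: vL.
by rewrite -!vw//; exact: vlip.
Qed.

Lemma eq_lip_num a b : (forall p, B p -> a p = b p) -> lip_num a -> lip_num b.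
Proof.
move=> vw [L L0 [vL vlip]]; exists L => //; split=> [p Bp|p q e Bp Bq pq].
  by rewrite -vw//; exact: vL.
by rewrite -!vw//; exact: vlip.
Qed.

Lemma lip_num_cst (k : R) : lip_num (fun=> k).
Proof.
exists `|k| => //; split=> // p q e _ _ /close_to_ge0 e0.
by rewrite subrr normr0 mulr_ge0.
Qed.

Lemma lip_numB a b : lip_num a -> lip_num b -> lip_num (fun p => a p - b p).
Proof.
move=> [L L0 [aL alip]] [L' L'0 [bL blip]]; exists (L + L'); first exact: addr_ge0.
split=> [p Bp|p q e Bp Bq pq].
  by rewrite (le_trans (ler_normB _ _))// lerD ?aL ?bL.
rewrite [X in `|X|](_ : _ = (a p - a q) - (b p - b q)); last by ring.
by rewrite mulrDl (le_trans (ler_normB _ _))// lerD ?alip ?blip.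
Qed.

Lemma lip_numM a b : lip_num a -> lip_num b -> lip_num (fun p => a p * b p).
Proof.
move=> [L L0 [aL alip]] [L' L'0 [bL blip]].
have LL0 := mulr_ge0 L0 L'0.
exists (2 * (L * L')); first by rewrite mulr_ge0.
split=> [p Bp|p q e Bp Bq pq].
  rewrite normrM; apply: (@le_trans _ _ (L * L')); last by lra.
  by apply: ler_pM => //; [exact: aL|exact: bL].
rewrite [X in `|X|](_ : _ = (a p - a q) * b p + a q * (b p - b q)); last by ring.
apply: le_trans (ler_normD _ _) _; rewrite !normrM.
have h1 := ler_pM (normr_ge0 _) (normr_ge0 _) (alip _ _ _ Bp Bq pq) (bL _ Bp).
have h2 := ler_pM (normr_ge0 _) (normr_ge0 _) (aL _ Bq) (blip _ _ _ Bp Bq pq).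
by apply: le_trans (lerD h1 h2) _; rewrite le_eqVlt; apply/orP; left; apply/eqP; ring.
Qed.

Lemma lip_num_sum (I : Type) (r : seq I) (a : I -> (sample R d -> R) -> R) :
  (forall i, lip_num (a i)) -> lip_num (fun p => \sum_(i <- r) a i p).
Proof.
move=> ha; elim: r => [|i r ih].
  by apply: eq_lip_num (lip_num_cst 0) => p _; rewrite big_nil.
have := lip_numB (ha i) (lip_numM (lip_num_cst (-1)) ih).
by apply: eq_lip_num => p _; rewrite big_cons mulN1r opprK.
Qed.

Lemma lip_numV a (c : R) : 0 < c -> (forall p, B p -> c <= a p) -> lip_num a ->
  lip_num (fun p => (a p)^-1).
Proof.
move=> c0 ca [L L0 [_ alip]].
have a0 p : B p -> 0 < a p by move=> /ca; exact: lt_le_trans.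
have aV p : B p -> (a p)^-1 <= c^-1 by move=> Bp; rewrite lef_pV2 ?posrE ?ca ?a0.
have cV0 : 0 <= c^-1 by rewrite invr_ge0 ltW.
exists (c^-1 + c^-1 * c^-1 * L); first by rewrite addr_ge0// !mulr_ge0.
split=> [p Bp|p q e Bp Bq pq].
  rewrite ger0_norm; last by rewrite invr_ge0 ltW ?a0.
  by rewrite (le_trans (aV _ Bp))// lerDl !mulr_ge0.
have e0 := close_to_ge0 pq.
rewrite mulrDl; apply: ler_wpDl; first exact: mulr_ge0.
have -> : (a p)^-1 - (a q)^-1 = (a p)^-1 * (a q)^-1 * (a q - a p).
  by field; rewrite !gt_eqF ?a0.
have app := ltW (a0 _ Bp); have aqp := ltW (a0 _ Bq).
rewrite normrM -[leRHS]mulrA; apply: ler_pM => //; last first.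
  by rewrite distrC alip.
rewrite ger0_norm ?mulr_ge0 ?invr_ge0//.
by apply: ler_pM; rewrite ?invr_ge0 ?aV.
Qed.

Lemma lip_fun_cst u (c : R) : C1a_le alpha u c -> lip_fun (fun=> u).
Proof.
move=> uc; exists c; first exact: C1a_le_ge0 uc.
split=> // p q e _ _ /close_to_ge0 e0; rewrite subrr.
by apply: C1a_leW (C1a_le0 _); rewrite mulr_ge0// (C1a_le_ge0 uc).
Qed.

Lemma lip_funB v w : lip_fun v -> lip_fun w -> lip_fun (fun p => v p - w p).
Proof.
move=> [L L0 [vL vlip]] [L' L'0 [wL wlip]]; exists (L + L'); first exact: addr_ge0.
split=> [p Bp|p q e Bp Bq pq]; first by apply: C1a_leB; [exact: vL|exact: wL].
rewrite (_ : _ - _ = (v p - v q) - (w p - w q)); last first.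
  by apply/funext => o; rewrite !fctE; ring.
by rewrite mulrDl; apply: C1a_leB; [exact: vlip|exact: wlip].
Qed.

Lemma lip_funZ a v : lip_num a -> lip_fun v -> lip_fun (fun p => a p *: v p).
Proof.
move=> [L L0 [aL alip]] [L' L'0 [vL vlip]].
have LL0 := mulr_ge0 L0 L'0.
exists (2 * (L * L')); first by rewrite mulr_ge0.
split=> [p Bp|p q e Bp Bq pq].
  apply: C1a_leW (C1a_leZ (a p) (vL p Bp)).
  apply: (@le_trans _ _ (L * L')); last by lra.
  by rewrite ler_wpM2r ?aL.
rewrite (_ : _ - _ = (a p - a q) *: v p + a q *: (v p - v q)); last first.
  by rewrite scalerBl scalerBr addrA subrK.
apply: C1a_leW (C1a_leD (C1a_leZ _ (vL p Bp)) (C1a_leZ _ (vlip p q e Bp Bq pq))).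
have h1 := ler_wpM2r L'0 (alip _ _ _ Bp Bq pq).
have h2 := ler_wpM2r (mulr_ge0 L'0 (close_to_ge0 pq)) (aL _ Bq).
by apply: le_trans (lerD h1 h2) _; rewrite le_eqVlt; apply/orP; left; apply/eqP; ring.
Qed.

Lemma lip_fun_sum (I : Type) (r : seq I) (v : I -> (sample R d -> R) -> sample R d -> R) :
  (forall i, lip_fun (v i)) -> lip_fun (fun p => \sum_(i <- r) v i p).
Proof.
move=> hv; elim: r => [|i r ih].
  by apply: eq_lip_fun (lip_fun_cst (C1a_le0 _)) => p _; rewrite big_nil.
have := lip_funB (hv i) (lip_funZ (lip_num_cst (-1)) ih).
by apply: eq_lip_fun => p _; rewrite big_cons scaleN1r opprK.
Qed.

Lemma lip_fun_eval v o : lip_fun v -> lip_num (fun p => v p o).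
Proof.
move=> [L L0 [vL vlip]]; exists L => //; split=> [p Bp|p q e Bp Bq pq].
  exact: C1a_le_abs (vL p Bp).
exact: C1a_le_abs o (vlip p q e Bp Bq pq).
Qed.

End lipschitz_calculus.

(** * The vector field on the ball of densities *)

Section gradient_flow_field.
Context {R : realType} {d n : nat}.
Variables (O : 'I_n -> sample R d) (sigma : R) (H : set (sample R d -> R))
  (ip : (sample R d -> R) -> (sample R d -> R) -> R) (alpha M M_K M1a : R).
Hypotheses (n_gt0 : (0 < n)%N) (sigma_gt0 : 0 < sigma).
Local Notation K := (@gauss_kernel R d sigma).
Local Notation mu := (sample_measure R d).
Hypotheses (HK : is_rkhs K H ip) (alpha_gt0 : 0 < alpha) (alpha_le1 : alpha <= 1).
Hypothesis M_K_def : kernel_C1a_sup alpha K = M_K%:E.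
Hypothesis M1a_def : centered_C1a_sup alpha K H ip O M = M1a%:E.
Implicit Types (o : sample R d) (f u p q : sample R d -> R).
Local Notation B := (@density_ball R d alpha M).
Local Notation F := (vector_field K H ip O).

Lemma C1a_le_bm u (c : R) : C1a_le alpha u c -> bounded_measurable u.
Proof.
move=> uc; split; last by exists c => o; exact: C1a_le_abs.
by apply: measurable_lipschitz => x x' a y; exact: C1a_le_lipschitz.
Qed.

Lemma density_ballP p : B p <->
  [/\ C1a_le alpha p M, forall o, 0 <= p o & \int[mu]_o p o = 1].
Proof.
split=> [[[pd _] p0 p1 pM]|[/C1a_leP[pd pM] p0 p1]].
  by split=> //; apply/C1a_leP.
by split=> //; split=> //; exact: le_lt_trans pM (ltry M).
Qed.

Lemma density_ball_density p : B p -> is_density p.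
Proof. by move=> /density_ballP[pM p0 p1]; split=> //; exact: C1a_le_bm pM. Qed.

Lemma gauss_kernel_C1a o' : C1a_le alpha (K ^~ o') M_K.
Proof.
apply/C1a_leP; split=> [a y i x|].
  by apply/cvg_ex; exists (gauss_grad sigma a y i x o'); exact: gauss_kernel_grad.
by rewrite -M_K_def; apply: ereal_sup_ubound; exists o'.
Qed.

Lemma gauss_section_C1a o : C1a_le alpha (K o) M_K.
Proof.
have -> : K o = K ^~ o by apply/funext => o'; exact: gauss_kernelC.
exact: gauss_kernel_C1a.
Qed.

Lemma integral_kernel_C1a f (c : R) : measurable_fun setT f ->
  (forall o, `|f o| <= c) ->
  C1a_le alpha (fun o => \int[mu]_o' (K o o' * f o'))
    ((1 + 2 * d%:R) * (M_K * c * total_mass (R := R) (d := d))).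
Proof.
apply: (@C1a_le_integral _ _ _ alpha_gt0 _ (@gauss_grad R d sigma)).
- by move=> a y o'; apply: C1a_le_bound (gauss_kernel_C1a o') _; exact: gauss_kernel_grad.
- exact: measurable_gauss_kernel.
- exact: measurable_gauss_grad.
Qed.

Lemma M_K_ge0 : 0 <= M_K.
Proof. exact: C1a_le_ge0 (gauss_kernel_C1a ([tuple (toI 0) | _ < d], true, true)). Qed.

(** The mean embedding is linear in the density, and the integral against the
    kernel gains the regularity of the kernel. *)
Lemma lip_mean_embedding : lip_fun alpha B (mean_embedding sigma).
Proof.
pose Z : R := total_mass (R := R) (d := d).
pose L := (1 + 2 * d%:R) * (M_K * Z) * (1 + `|M|).
have Z0 : 0 <= Z by exact: total_mass_ge0.
have A0 : 0 <= (1 + 2 * d%:R) * (M_K * Z).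
  by rewrite mulr_ge0 ?addr_ge0 ?mulr_ge0// M_K_ge0.
exists L; first by rewrite mulr_ge0 ?addr_ge0.
split=> [p /density_ballP[pM p0 _]|p q e Bp Bq pq].
  have [mp _] := C1a_le_bm pM.
  apply: C1a_leW (integral_kernel_C1a mp (fun o => C1a_le_abs o pM)).
  apply: (@le_trans _ _ ((1 + 2 * d%:R) * (M_K * Z) * `|M|)); last first.
    by rewrite /L ler_wpM2l// lerDr.
  apply: (@le_trans _ _ ((1 + 2 * d%:R) * (M_K * Z) * M)).
    by rewrite le_eqVlt; apply/orP; left; apply/eqP; rewrite -/Z; ring.
  by rewrite ler_wpM2l// ler_norm.
have e0 := close_to_ge0 pq.
have [bp _ _] := density_ball_density Bp; have [bq _ _] := density_ball_density Bq.
have -> : mean_embedding sigma p - mean_embedding sigma q =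
    fun o => \int[mu]_o' (K o o' * (p o' - q o')).
  apply/funext => o; rewrite !fctE /mean_embedding /expect -bm_intB.
  - by apply: eq_Rintegral => o' _; rewrite mulrBr.
  - by apply: bmM => //; exact: gauss_kernel_bm.
  - by apply: bmM => //; exact: gauss_kernel_bm.
apply: C1a_leW (integral_kernel_C1a (bmB bp bq).1 pq).
have -> : L * e = (1 + 2 * d%:R) * (M_K * Z) * e + (1 + 2 * d%:R) * (M_K * Z) * (`|M| * e).
  by rewrite /L; ring.
rewrite -[leLHS]addr0; apply: lerD; last by apply: mulr_ge0 => //; exact: mulr_ge0.
by rewrite le_eqVlt; apply/orP; left; apply/eqP; rewrite -/Z; ring.
Qed.

Lemma lip_embedding_norm2 : lip_num B (embedding_norm2 sigma).
Proof.
have [L L0 [mL mlip]] := lip_mean_embedding.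
pose Z : R := total_mass (R := R) (d := d).
have Z0 : 0 <= Z by exact: total_mass_ge0.
have e_bm p : B p -> bounded_measurable (mean_embedding sigma p).
  by move=> /density_ball_density; exact: (mean_embedding_bm sigma_gt0 HK).
exists (L + (L * `|M| + L) * Z); first by rewrite !addr_ge0 ?mulr_ge0 ?addr_ge0 ?mulr_ge0.
have LZ0 : 0 <= (L * `|M| + L) * Z by rewrite mulr_ge0 ?addr_ge0 ?mulr_ge0.
split=> [p Bp|p q e Bp Bq pq].
  apply: (@le_trans _ _ L); last by rewrite lerDl.
  apply: expect_abs (density_ball_density Bp) (e_bm _ Bp) _ => o.
  exact: C1a_le_abs (mL p Bp).
have e0 := close_to_ge0 pq.
have [bp _ _] := density_ball_density Bp; have [bq _ _] := density_ball_density Bq.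
have ep := e_bm _ Bp; have eq_ := e_bm _ Bq.
rewrite /embedding_norm2 /expect -bm_intB; [|exact: bmM..].
apply: (@le_trans _ _ ((L * e * `|M| + L * e) * Z)); last first.
  have -> : (L + (L * `|M| + L) * Z) * e = L * e + (L * e * `|M| + L * e) * Z by ring.
  by rewrite lerDr mulr_ge0.
apply: bm_int_bound => [|o]; first by apply: bmB; exact: bmM.
rewrite [X in `|X|](_ : _ = (mean_embedding sigma p o - mean_embedding sigma q o) * p o
  + mean_embedding sigma q o * (p o - q o)); last by ring.
apply: le_trans (ler_normD _ _) _; rewrite !normrM; apply: lerD; apply: ler_pM => //.
- exact: C1a_le_abs o (mlip p q e Bp Bq pq).
- apply: le_trans (ler_norm M).
  by move: Bp => /density_ballP[pM _ _]; exact: C1a_le_abs pM.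
- exact: C1a_le_abs (mL q Bq).
Qed.

(** The squared norm of the mean embedding of a density is bounded below by a
    positive lower bound of the kernel, so its inverse is as regular as itself. *)
Lemma lip_embedding_norm2V : lip_num B (fun p => (embedding_norm2 sigma p)^-1).
Proof.
apply: (lip_numV (c := gauss_lower (d := d) sigma)) lip_embedding_norm2.
  exact: gauss_lower_gt0.
by move=> p /density_ball_density; exact: (embedding_norm2_ge sigma_gt0 HK).
Qed.

Lemma lip_mean_embedding_at o : lip_num B (fun p => mean_embedding sigma p o).
Proof. exact: lip_fun_eval lip_mean_embedding. Qed.

Lemma lip_centered_section o : lip_fun alpha B (fun p => centered_section K H ip p o).
Proof.
have := lip_funB (lip_fun_cst B (gauss_section_C1a o))
  (lip_funZ (lip_numM (lip_mean_embedding_at o) lip_embedding_norm2V) lip_mean_embedding).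
by apply: eq_lip_fun => p /density_ball_density pd; rewrite (centered_sectionE sigma_gt0 HK).
Qed.

Lemma lip_centered_kernel o o' : lip_num B (fun p => centered_kernel K H ip p o o').
Proof.
have := lip_numB (lip_num_cst B (K o o'))
  (lip_numM (lip_numM (lip_mean_embedding_at o) (lip_mean_embedding_at o'))
     lip_embedding_norm2V).
by apply: eq_lip_num => p /density_ball_density pd; rewrite (centered_kernelE sigma_gt0 HK).
Qed.

Lemma directionE p : direction K H ip O p = n%:R^-1 *:
  \sum_(j < n) direction_coef K H ip O p j *: centered_section K H ip p (O j).
Proof.
by apply/funext => o; rewrite /direction !fctE fct_sumE.
Qed.

Lemma lip_direction : lip_fun alpha B (direction K H ip O).
Proof.
have coef j : lip_num B (fun p => direction_coef K H ip O p j).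
  apply: lip_numM (lip_num_cst B n%:R^-1) _.
  by apply: lip_num_sum => i; exact: lip_centered_kernel.
have := lip_funZ (lip_num_cst B n%:R^-1)
  (lip_fun_sum (index_enum 'I_n) (fun j => lip_funZ (coef j) (lip_centered_section (O j)))).
by apply: eq_lip_fun => p _; rewrite directionE.
Qed.

Lemma centered_section_C1a p j : B p -> C1a_le alpha (centered_section K H ip p (O j)) M1a.
Proof.
move=> Bp; have [L _ [secL _]] := lip_centered_section (O j).
apply/C1a_leP; split; first exact: (iffLR (C1a_leP _ _ _) (secL p Bp)).1.
by rewrite -M1a_def; apply: ereal_sup_ubound; exists (p, j).
Qed.

Lemma direction_coef_abs p j : B p -> `|direction_coef K H ip O p j| <= 1.
Proof.
move=> /density_ball_density pd; rewrite normrM normfV normr_nat.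
rewrite ler_pdivrMl ?ltr0n// mulr1 (le_trans (ler_norm_sum _ _ _))//.
rewrite -[X in _ <= X%:R]card_ord -sum1_card natr_sum.
by apply: ler_sum => i _; exact: (centered_kernel_abs sigma_gt0 HK).
Qed.

Lemma direction_C1a p : B p -> C1a_le alpha (direction K H ip O p) M1a.
Proof.
move=> Bp; rewrite directionE.
have M1a0 : 0 <= M1a by exact: C1a_le_ge0 (centered_section_C1a (Ordinal n_gt0) Bp).
have h j : C1a_le alpha (direction_coef K H ip O p j *: centered_section K H ip p (O j)) M1a.
  apply: C1a_leW (C1a_leZ _ (centered_section_C1a j Bp)).
  by rewrite ler_piMl ?direction_coef_abs.
apply: C1a_leW (C1a_leZ n%:R^-1 (C1a_le_sum _ h)).
by rewrite sumr_const card_ord normfV normr_nat -[M1a *+ n]mulr_natl mulKf// pnatr_eq0 -lt0n.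
Qed.

Lemma M1a_ge0 p : B p -> 0 <= M1a.
Proof. by move=> /direction_C1a/C1a_le_ge0. Qed.

(** The direction at [p] is centered under [p]: this is the conservation of mass
    along the flow. *)
Lemma expect_direction p : B p -> \int[mu]_o F p o = 0.
Proof.
move=> Bp; have pd := density_ball_density Bp; have [bp _ _] := pd.
have bs j : bounded_measurable (centered_section K H ip p (O j)).
  exact: C1a_le_bm (centered_section_C1a j Bp).
have lin (a : R) f g := @expect_lin R d p a f g pd.
have -> : \int[mu]_o F p o = expect p (direction K H ip O p).
  by apply: eq_Rintegral => o _; rewrite /vector_field mulrC.
have e0 : expect p 0 = 0.
  have := lin 1 0 0 (bm_cst 0) (bm_cst 0).
  by rewrite scale1r addr0 mul1r => /eqP; rewrite -subr_eq subrr => /eqP <-.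
rewrite directionE -[_ *: _]addr0.
suff [bS S0] : bounded_measurable (\sum_(j < n) direction_coef K H ip O p j *:
    centered_section K H ip p (O j)) /\ expect p (\sum_(j < n)
    direction_coef K H ip O p j *: centered_section K H ip p (O j)) = 0.
  by rewrite lin ?S0 ?mulr0 ?e0 ?addr0//; exact: bm_cst.
elim/big_rec : _ => [|j S _ [bS S0]]; first by split=> //; exact: bm_cst.
split; first by apply: bmD => //; exact: bmZ.
by rewrite lin// (expect_centered sigma_gt0 HK)// mulr0 add0r.
Qed.

Local Notation Calg := (1 + 2 * hoelder_diam (R := R) (d := d) alpha).

Lemma vector_field_C1a p (c : R) : B p -> C1a_le alpha p c ->
  C1a_le alpha (F p) (Calg * (c * M1a)).
Proof.
move=> Bp pc; have := C1a_leM alpha_le1 pc (direction_C1a Bp).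
by rewrite (_ : F p = p * direction K H ip O p).
Qed.

(** The Lipschitz bound for the product [p * D(p)] uses the norm of [p - q] in the
    first term of the product rule, but only its supremum in the second. *)
Lemma vector_field_lipschitz : exists2 L, 0 <= L & forall p q e, B p -> B q ->
  C1a_le alpha (p - q) e -> C1a_le alpha (F p - F q) (L * e).
Proof.
have [L L0 [_ Dlip]] := lip_direction.
have D0 := @hoelder_diam_ge0 R d alpha.
exists (Calg * (`|M1a| + `|M| * L)).
  by rewrite mulr_ge0 ?addr_ge0 ?mulr_ge0.
move=> p q e Bp Bq pq.
have e0 := C1a_le_ge0 pq.
have -> : F p - F q = (p - q) * direction K H ip O p +
    q * (direction K H ip O p - direction K H ip O q).
  by apply/funext => o; rewrite !fctE /vector_field; ring.
have [qM _ _] := iffLR (density_ballP q) Bq.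
have cl : close_to p q e by move=> o; exact: C1a_le_abs o pq.
apply: C1a_leW (C1a_leD (C1a_leM alpha_le1 pq (direction_C1a Bp)) (C1a_leM alpha_le1 qM (Dlip p q e Bp Bq cl))) => //.
rewrite -mulrDr -mulrA ler_wpM2l ?addr_ge0 ?mulr_ge0// mulrDl lerD//.
  by rewrite mulrC ler_wpM2r// ler_norm.
by rewrite mulrA ler_wpM2r// ler_wpM2r// ler_norm.
Qed.

Lemma vector_field_sup_lipschitz : exists2 L, 0 <= L & forall p q e, B p -> B q ->
  close_to p q e -> close_to (F p) (F q) (L * e).
Proof.
have [L L0 [_ Dlip]] := lip_direction.
exists (`|M1a| + `|M| * L); first by rewrite addr_ge0 ?mulr_ge0.
move=> p q e Bp Bq pq o; have [qM _ _] := iffLR (density_ballP q) Bq.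
have Dp := C1a_le_abs o (direction_C1a Bp); have := C1a_le_abs o (Dlip p q e Bp Bq pq).
have qo := C1a_le_abs o qM; rewrite !fctE /vector_field.
move: (direction K H ip O p o) (direction K H ip O q o) Dp => u v Dp Dpq.
have -> : p o * u - q o * v = u * (p o - q o) + q o * (u - v) by ring.
rewrite mulrDl -[_ * L * e]mulrA; apply: le_trans (ler_normD _ _) _; rewrite !normrM.
apply: lerD; apply: ler_pM => //; first exact: le_trans Dp (ler_norm _).
exact: le_trans qo (ler_norm _).
Qed.

(** An explicit Euler step multiplies a density by [1 + h * D], which preserves
    the mass because the centered sections have expectation zero, preserves the
    sign for small [h], and multiplies the norm by at most [1 + h * Lambda]. *)
Lemma euler_step_ball p (h c : R) : B p -> 0 <= h -> h * M1a <= 1 ->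
  C1a_le alpha p c -> c * (1 + h * (Calg * M1a)) <= M ->
  B (p + h *: F p) /\ C1a_le alpha (p + h *: F p) (c * (1 + h * (Calg * M1a))).
Proof.
move=> Bp h0 hM pc cM.
have sc : C1a_le alpha (p + h *: F p) (c * (1 + h * (Calg * M1a))).
  have -> : c * (1 + h * (Calg * M1a)) = c + `|h| * (Calg * (c * M1a)).
    by rewrite ger0_norm//; ring.
  by apply: C1a_leD => //; apply: C1a_leZ; exact: vector_field_C1a.
have [pM p0 p1] := iffLR (density_ballP p) Bp.
split; last exact: sc.
apply: (iffRL (density_ballP _)).
split; first exact: C1a_leW sc.
- move=> o; have -> : (p + h *: F p) o = p o * (1 + h * direction K H ip O p o).
    rewrite !fctE /vector_field -[h *: _]/(h * _); ring.
  have := C1a_le_abs o (direction_C1a Bp); rewrite ler_norml => /andP[D1 _].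
  by rewrite mulr_ge0//; have := ler_wpM2l h0 D1; lra.
- have bF : bounded_measurable (F p) by apply: C1a_le_bm (vector_field_C1a Bp pc).
  have [bp _ _] := density_ball_density Bp.
  rewrite (bm_intD bp (bmZ h bF)) (bm_intZ _ bF) expect_direction//.
  by rewrite p1 mulr0 addr0.
Qed.

End gradient_flow_field.

(** * The Euler scheme in a complete set of a normed space *)

Lemma sub_chain (W : zmodType) (X Y x y a b c : W) :
  x - y - b = (X - Y - a) - (X - x) + (Y - y) + (a - c) + (c - b).
Proof.
rewrite opprB.
have -> : X - Y - a + (x - X) = x - Y - a by rewrite addrC !addrA subrK.
have -> : x - Y - a + (Y - y) = x - y - a by rewrite addrAC addrA subrK.
by rewrite [_ - a + _]addrA subrK addrA subrK.
Qed.

Section euler_scheme.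
Context {R : realType} {V : lmodType R}.
(* A norm is given by the relation that says that the norm of a vector is at most
   a number, as [C1a_le] is. *)
Variable le_norm : V -> R -> Prop.
Hypotheses (le_normW : forall u (c c' : R), c <= c' -> le_norm u c -> le_norm u c')
  (le_normD : forall u v (c c' : R), le_norm u c -> le_norm v c' -> le_norm (u + v) (c + c'))
  (le_normZ : forall (k : R) u (c : R), le_norm u c -> le_norm (k *: u) (`|k| * c))
  (le_norm_closed : forall u (c : R),
     (forall eps, 0 < eps -> le_norm u (c + eps)) -> le_norm u c)
  (le_norm_sep : forall u, (forall eps, 0 < eps -> le_norm u eps) -> u = 0).
Variables (B : set V) (F : V -> V) (bF L T : R) (p0 : V) (N0 : nat).
Hypotheses (bF_ge0 : 0 <= bF) (L_ge0 : 0 <= L) (T_ge0 : 0 <= T).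
Hypothesis B_complete : forall u_ : nat -> V, (forall m, B (u_ m)) ->
  (forall eps, 0 < eps -> exists N, forall m n, (N <= m)%N -> (N <= n)%N ->
     le_norm (u_ m - u_ n) eps) ->
  exists2 u, B u & forall eps, 0 < eps -> exists N, forall m, (N <= m)%N ->
    le_norm (u_ m - u) eps.
Hypothesis F_bound : forall p, B p -> le_norm (F p) bF.
Hypothesis F_lipschitz : forall p q e, B p -> B q -> le_norm (p - q) e ->
  le_norm (F p - F q) (L * e).

(** The offset [N0] discards the coarse subdivisions, for which an Euler step
    may leave [B]. *)
Definition step (m : nat) : R := T / (2 ^ (N0 + m))%:R.

Definition euler (m k : nat) : V := iter k (fun p => p + step m *: F p) p0.

Hypothesis euler_in : forall m k, (k <= 2 ^ (N0 + m))%N -> B (euler m k).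

Lemma step_ge0 m : 0 <= step m.
Proof. by rewrite divr_ge0. Qed.

Lemma stepS m : step m.+1 = step m / 2.
Proof. by rewrite /step addnS expnS mulnC natrM invfM mulrA. Qed.

Lemma step_total m : step m * (2 ^ (N0 + m))%:R = T.
Proof. by rewrite divfK// pnatr_eq0 expn_eq0. Qed.

Lemma step_small eps : 0 < eps -> exists N, forall m, (N <= m)%N -> step m <= eps.
Proof.
move=> e0; exists (Num.truncn (T / eps)) => m Nm.
rewrite ler_pdivrMr ?ltr0n ?expn_gt0// -ler_pdivrMl// mulrC.
apply/ltW/(lt_le_trans (truncnS_gt _)); rewrite ler_nat.
apply: leq_trans (_ : (2 ^ m <= _)%N); last by rewrite leq_exp2l// leq_addl.
by apply: leq_ltn_trans Nm _; exact: ltn_expl.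
Qed.

Lemma le_normN u c : le_norm u c -> le_norm (- u) c.
Proof. by move=> /(le_normZ (-1)); rewrite scaleN1r normrN1 mul1r. Qed.

Lemma le_normB u v c c' : le_norm u c -> le_norm v c' -> le_norm (u - v) (c + c').
Proof. by move=> uc /le_normN; exact: le_normD. Qed.

Lemma le_norm0 : B p0 -> le_norm 0 0.
Proof. by move=> /F_bound/(le_normZ 0); rewrite scale0r normr0 mul0r. Qed.

Lemma p0_in : B p0.
Proof. exact: (@euler_in 0 0). Qed.

Lemma euler_dist m k j : (k + j <= 2 ^ (N0 + m))%N ->
  le_norm (euler m (k + j) - euler m k) (j%:R * step m * bF).
Proof.
elim: j => [_|j ih kj]; first by rewrite addn0 subrr !mul0r; exact: le_norm0 p0_in.
rewrite addnS /= -/(euler m (k + j)) addrAC -natr1 !mulrDl mul1r.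
have kj' : (k + j <= 2 ^ (N0 + m))%N by apply: leq_trans kj; rewrite addnS.
apply: le_normD; first exact: ih.
have := le_normZ (step m) (F_bound (euler_in kj')).
by rewrite ger0_norm ?step_ge0.
Qed.

(** The increments of the nodes are values of the field at nodes that are
    themselves at a distance of the order of the elapsed time, and the field is
    Lipschitz: the error is quadratic in the elapsed time. *)
Lemma euler_local m k j : (k + j <= 2 ^ (N0 + m))%N ->
  le_norm (euler m (k + j) - euler m k - (j%:R * step m) *: F (euler m k))
    (L * bF * (j%:R * step m) ^+ 2).
Proof.
have h0 := step_ge0 m.
elim: j => [_|j ih kj].
  rewrite addn0 subrr mul0r scale0r subrr expr0n mulr0; exact: le_norm0 p0_in.
have kj' : (k + j <= 2 ^ (N0 + m))%N by apply: leq_trans kj; rewrite addnS.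
have k' : (k <= 2 ^ (N0 + m))%N by apply: leq_trans kj'; exact: leq_addr.
rewrite addnS /= -/(euler m (k + j)) -natr1 mulrDl mul1r.
set e := euler m (k + j); set e' := euler m k; set h := step m in h0 *.
have -> : e + h *: F e - e' - (j%:R * h + h) *: F e' =
    (e - e' - (j%:R * h) *: F e') + h *: (F e - F e').
  rewrite scalerDl scalerBr opprD !addrA; congr (_ - _).
  by rewrite [e + _ - e']addrAC [RHS]addrAC.
have FL := F_lipschitz (euler_in kj') (euler_in k') (euler_dist kj').
apply: le_normW (le_normD (ih kj') (le_normZ h FL)).
rewrite ger0_norm// -/h.
have LB : 0 <= L * bF * h ^+ 2 by rewrite !mulr_ge0 ?exprn_ge0.
have jj : 0 <= (j%:R : R) by [].
have : 0 <= L * bF * h ^+ 2 * (j%:R + 1) by rewrite mulr_ge0// addr_ge0.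
rewrite (_ : L * bF * (j%:R * h + h) ^+ 2 = L * bF * (j%:R * h) ^+ 2 +
  h * (L * (j%:R * h * bF)) + L * bF * h ^+ 2 * (j%:R + 1)); last by ring.
by lra.
Qed.

(** The constant of the discrete Gronwall inequality: each step contributes a
    local error [L * bF * step ^ 2], amplified by at most [exp (L * T)]. *)
Definition refine_const : R := T * (L * bF) * expR (L * T).

Lemma refine_const_ge0 : 0 <= refine_const.
Proof. by rewrite !mulr_ge0// expR_ge0. Qed.

(** Two half steps differ from a full step by the local error [euler_local];
    the distance [e] of the nodes evolves by [e' <= (1 + step * L) * e + error]. *)
Lemma euler_refine m k : (k <= 2 ^ (N0 + m))%N ->
  le_norm (euler m.+1 k.*2 - euler m k) (refine_const * step m).
Proof.
have h0 := step_ge0 m; set h := step m in h0 *.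
have LB0 : 0 <= L * bF by exact: mulr_ge0.
have hL1 : 1 <= 1 + h * L by rewrite lerDl mulr_ge0.
have hL0 := le_trans ler01 hL1.
have key : (k <= 2 ^ (N0 + m))%N -> le_norm (euler m.+1 k.*2 - euler m k)
    (k%:R * (L * bF * h ^+ 2) * (1 + h * L) ^+ k).
  elim: k => [_|k ih km]; first by rewrite /= subrr !mul0r; exact: le_norm0 p0_in.
  have km' := ltnW km.
  have k2m : (k.*2 + 2 <= 2 ^ (N0 + m.+1))%N.
    by rewrite addn2 -doubleS addnS expnS -mul2n leq_mul2l.
  have k2m' : (k.*2 <= 2 ^ (N0 + m.+1))%N by apply: leq_trans k2m; exact: leq_addr.
  have loc := euler_local k2m.
  rewrite stepS -/h mulrC divfK// in loc.
  rewrite doubleS -addn2.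
  set e := euler m.+1 (k.*2 + 2) in loc *; set e' := euler m.+1 k.*2 in loc ih *.
  rewrite /= -/(euler m k) -/h; set q := euler m k in ih *.
  have -> : e - (q + h *: F q) = (e - e' - h *: F e') + (e' - q) + h *: (F e' - F q).
    by rewrite scalerBr [X in _ = X + _]addrAC [e - e' + _]addrA subrK addrA subrK
      opprD addrA.
  have FL := F_lipschitz (euler_in k2m') (euler_in km') (ih km').
  apply: le_normW (le_normD (le_normD loc (ih km')) (le_normZ h FL)).
  rewrite ger0_norm//; set a := L * bF * h ^+ 2; set r := 1 + h * L in hL1 *.
  have a0 : 0 <= a by rewrite mulr_ge0// exprn_ge0.
  have rk : a <= a * r ^+ k.+1 by rewrite ler_peMr// exprn_ege1.
  rewrite -natr1 [(k%:R + 1) * a]mulrDl mul1r mulrDl.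
  suff -> : a + k%:R * a * r ^+ k + h * (L * (k%:R * a * r ^+ k)) =
    a + k%:R * a * r ^+ k.+1 by lra.
  by rewrite exprS /r; ring.
move=> km; apply: le_normW (key km).
have kh : k%:R * h <= T by rewrite -(step_total m) mulrC ler_wpM2l// ler_nat.
have -> : k%:R * (L * bF * h ^+ 2) * (1 + h * L) ^+ k =
  (k%:R * h) * (L * bF) * (1 + h * L) ^+ k * h by ring.
rewrite /refine_const ler_wpM2r//; apply: ler_pM => //.
- by rewrite !mulr_ge0.
- by rewrite exprn_ge0.
- by rewrite ler_wpM2r.
apply: (@le_trans _ _ (expR (h * L) ^+ k)).
  by apply: lerXn2r; rewrite ?nnegrE ?expR_ge0 ?expR_ge1Dx.
rewrite -expRM_natl ler_expR; apply: le_trans (_ : k%:R * h * L <= _).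
  by rewrite mulrA.
by rewrite mulrC ler_wpM2l.
Qed.

Definition node (m : nat) (t : R) : nat := Num.truncn (t / step m).

Lemma nodeP m t : 0 <= t <= T ->
  [/\ (node m t <= 2 ^ (N0 + m))%N, (node m t)%:R * step m <= t &
      t <= (node m t)%:R * step m + step m].
Proof.
move=> /andP[t0 tT]; rewrite /node; have := step_ge0 m.
rewrite le_eqVlt => /orP[/eqP h0|h0].
  have T0 : T = 0 by rewrite -(step_total m) -h0 mul0r.
  by rewrite -h0 invr0 !mulr0 truncn0 addr0; split=> //; rewrite -T0.
have q0 : 0 <= t / step m by rewrite divr_ge0// ltW.
have /andP[n1 n2] := truncn_itv q0; split.
- rewrite -(@ler_nat R) (le_trans n1)// ler_pdivrMr// mulrC step_total//.
- by rewrite -ler_pdivlMr.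
- by rewrite -[X in _ + X]mul1r -mulrDl natr1 -ler_pdivrMr// ltW.
Qed.

Definition polygon (m : nat) (t : R) : V := euler m (node m t).

Lemma polygon_in m t : 0 <= t <= T -> B (polygon m t).
Proof. by move=> /(nodeP m)[n1 _ _]; exact: euler_in. Qed.

Lemma polygon_refine m t : 0 <= t <= T ->
  le_norm (polygon m.+1 t - polygon m t) ((refine_const + bF) * step m).
Proof.
move=> t0T; have [k1 k2 k3] := nodeP m t0T; have [l1 l2 _] := nodeP m.+1 t0T.
have kl : ((node m t).*2 <= node m.+1 t)%N.
  have := step_ge0 m; rewrite le_eqVlt => /orP[/eqP h0|h0].
    by rewrite {1}/node -h0 invr0 mulr0 truncn0.
  have h'0 : 0 < step m.+1 by rewrite stepS divr_gt0.
  have /andP[t0 _] := t0T.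
  have q0 : 0 <= t / step m.+1 by rewrite divr_ge0// ltW.
  rewrite {2}/node truncn_ge_nat// ler_pdivlMr// stepS.
  by rewrite -muln2 natrM -mulrA [2 * _]mulrC divfK.
rewrite /polygon -(subnKC kl).
set k := node m t in k1 k2 k3 kl *; set l := node m.+1 t in l1 l2 kl *.
have -> : euler m.+1 (k.*2 + (l - k.*2)) - euler m k =
    (euler m.+1 (k.*2 + (l - k.*2)) - euler m.+1 k.*2) +
    (euler m.+1 k.*2 - euler m k) by rewrite addrA subrK.
have kll : (k.*2 + (l - k.*2) <= 2 ^ (N0 + m.+1))%N by rewrite subnKC.
apply: le_normW (le_normD (euler_dist kll) (euler_refine k1)).
rewrite addrC mulrDl lerD2l natrB// mulrBl mulrC ler_wpM2l//.
rewrite [X in _ - X](_ : _ = k%:R * step m); first by lra.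
by rewrite stepS -muln2 natrM -mulrA [2 * _]mulrC divfK.
Qed.

Lemma polygon_cauchy m j t : 0 <= t <= T ->
  le_norm (polygon (m + j) t - polygon m t)
    ((refine_const + bF) * (2 * step m - 2 * step (m + j))).
Proof.
move=> t0T; elim: j => [|j ih].
  by rewrite addn0 !subrr mulr0; exact: le_norm0 p0_in.
have -> : polygon (m + j.+1) t - polygon m t =
    (polygon (m + j.+1) t - polygon (m + j) t) + (polygon (m + j) t - polygon m t).
  by rewrite addrA subrK.
rewrite addnS; apply: le_normW (le_normD (polygon_refine (m + j) t0T) ih).
by rewrite -mulrDr stepS le_eqVlt; apply/orP; left; apply/eqP; congr (_ * _); field.
Qed.

Lemma polygon_limit : exists p : R -> V, forall t, 0 <= t <= T ->
  B (p t) /\ forall eps, 0 < eps -> exists N, forall m, (N <= m)%N ->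
    le_norm (polygon m t - p t) eps.
Proof.
suff /choice[p pP] : forall t, exists u, 0 <= t <= T ->
  B u /\ forall eps, 0 < eps -> exists N, forall m, (N <= m)%N ->
    le_norm (polygon m t - u) eps by exists p.
move=> t; have [t0T|] := boolP (0 <= t <= T); last by exists 0.
have [||u Bu ulim] := B_complete (u_ := polygon ^~ t).
- by move=> m; exact: polygon_in.
- move=> eps e0; pose c := refine_const + bF.
  have c0 : 0 <= c by rewrite addr_ge0// refine_const_ge0.
  have d0 : 0 < 2 * c + 1 by rewrite ltr_wpDl// mulr_ge0.
  have [N hN] := step_small (divr_gt0 e0 d0).
  have key m n : (N <= m)%N -> (m <= n)%N -> le_norm (polygon n t - polygon m t) eps.
    move=> Nm /subnKC <-; apply: le_normW (polygon_cauchy m (n - m) t0T).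
    rewrite -/c; have := hN _ Nm; rewrite ler_pdivlMr//.
    have s1 := step_ge0 m; have s2 := step_ge0 (m + (n - m)).
    by have := mulr_ge0 c0 s1; have := mulr_ge0 c0 s2; lra.
  exists N => m n Nm Nn; have [mn|/ltnW nm] := leqP m n; last exact: key.
  by rewrite -opprB; apply: le_normN; exact: key.
- by exists u.
Qed.

(** The polygons are Cauchy by [euler_refine].  Their nodes satisfy the
    differential equation up to an error quadratic in the elapsed time
    ([euler_local]), and this estimate passes to the limit, where it gives the
    derivative. *)
Lemma euler_solution : exists p : R -> V,
  [/\ p 0 = p0, forall t, 0 <= t <= T -> B (p t) & exists2 A, 0 <= A &
    forall s t, 0 <= s <= T -> 0 <= t <= T ->
      le_norm (p s - p t) (A * `|s - t|) /\
      le_norm (p s - p t - (s - t) *: F (p t)) (A * (s - t) ^+ 2)].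
Proof.
have [p pP] := polygon_limit; exists p.
have pB t : 0 <= t <= T -> B (p t) by move=> /pP[].
have plim t eps : 0 <= t <= T -> 0 < eps -> exists N, forall m, (N <= m)%N ->
  le_norm (polygon m t - p t) eps by move=> /pP[_]; apply.
split=> //.
  apply/eqP; rewrite eq_sym -subr_eq0; apply/eqP/le_norm_sep => eps e0.
  have z0T : 0 <= (0 : R) <= T by rewrite lexx.
  have [N /(_ _ (leqnn N))] := plim 0 eps z0T e0.
  by rewrite /polygon /node mul0r truncn0.
pose A0 := L * bF; have A00 : 0 <= A0 by exact: mulr_ge0.
(* The estimate [euler_local] for the nodes next to [t] and [s], when the mesh
   and the distances of the polygon to the limit are below [eta]. *)
have fwd s t : 0 <= s <= T -> 0 <= t <= T -> t <= s ->
    le_norm (p s - p t - (s - t) *: F (p t)) (A0 * (s - t) ^+ 2).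
  move=> sT tT ts; apply: le_norm_closed => eps e0.
  pose D := A0 * (2 * T + 1) + 2 + bF + T * L.
  have D0 : 0 < D.
    rewrite /D -!addrA ltr_wpDl//; first by rewrite mulr_ge0// addr_ge0// mulr_ge0.
    by rewrite ltr_wpDr ?addr_ge0 ?mulr_ge0.
  pose eta := Num.min 1 (eps / D).
  have eta0 : 0 < eta by rewrite lt_min ltr01 divr_gt0.
  have eta1 : eta <= 1 by rewrite ge_min lexx.
  have etaD : eta * D <= eps by rewrite -ler_pdivlMr// ge_min lexx orbT.
  have [N1 h1] := plim s eta sT eta0; have [N2 h2] := plim t eta tT eta0.
  have [N3 h3] := step_small eta0.
  pose m := maxn N1 (maxn N2 N3).
  have {}h1 := h1 m (leq_maxl _ _).
  have {}h2 : le_norm (polygon m t - p t) eta.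
    by apply: h2; rewrite leq_max leq_maxl orbT.
  have {}h3 : step m <= eta by apply: h3; rewrite !leq_max leqnn !orbT.
  have [k1 k2 k3] := nodeP m tT; have [l1 l2 l3] := nodeP m sT.
  have kl : (node m t <= node m s)%N.
    by apply: le_truncn; rewrite ler_wpM2r// invr_ge0 step_ge0.
  have kll : (node m t + (node m s - node m t) <= 2 ^ (N0 + m))%N by rewrite subnKC.
  have := euler_local kll; rewrite subnKC// natrB// mulrBl.
  have FP := F_bound (polygon_in m tT).
  have FL := F_lipschitz (polygon_in m tT) (pB _ tT) h2.
  rewrite -/(polygon m s) -/(polygon m t).
  set a := node _ _ in k1 k2 k3 kl kll *; set b := node _ _ in l1 l2 l3 kl kll *.
  set r := b%:R * step m - a%:R * step m => loc.
  have -> : p s - p t - (s - t) *: F (p t) =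
    (polygon m s - polygon m t - r *: F (polygon m t)) - (polygon m s - p s)
    + (polygon m t - p t) + (r - (s - t)) *: F (polygon m t)
    + (s - t) *: (F (polygon m t) - F (p t)).
    by rewrite [(r - _) *: _]scalerBl [_ *: (_ - _)]scalerBr; exact: sub_chain.
  apply: le_normW (le_normD (le_normD (le_normD (le_normB loc h1) h2)
    (le_normZ _ FP)) (le_normZ _ FL)).
  have h0 := step_ge0 m.
  have ka : a%:R * step m <= b%:R * step m by rewrite ler_wpM2r// ler_nat.
  have r0 : 0 <= r by rewrite subr_ge0.
  have rs : `|r - (s - t)| <= eta by rewrite ler_norml /r; lra.
  have s0 : 0 <= s - t by rewrite subr_ge0.
  have sT' : s - t <= T by case/andP: sT => _ sT; case/andP: tT => tT _; lra.
  rewrite (ger0_norm s0).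
  have e1 : A0 * r ^+ 2 <= A0 * ((s - t) ^+ 2 + (2 * T + 1) * eta).
    apply: ler_wpM2l => //; apply: (@le_trans _ _ ((s - t + eta) ^+ 2)).
      rewrite ler_pXn2r ?nnegrE//; first by move: rs; rewrite ler_norml; lra.
      by lra.
    rewrite sqrrD -addrA lerD2l [leRHS]mulrDl mul1r; apply: lerD; last first.
      by rewrite expr2 ler_piMl// ltW.
    rewrite -mulr_natl -mulrA ler_wpM2l// ler_wpM2r// ltW//.
  have e2 := ler_wpM2r bF_ge0 rs.
  have e3 : (s - t) * (L * eta) <= T * (L * eta) by rewrite ler_wpM2r// mulr_ge0// ltW.
  by move: etaD e1; rewrite /D -/A0; lra.
pose A1 := A0 * T + bF.
have A10 : 0 <= A1 by rewrite addr_ge0// mulr_ge0.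
have lip_fwd s t : 0 <= s <= T -> 0 <= t <= T -> t <= s ->
    le_norm (p s - p t) (A1 * `|s - t|).
  move=> sT tT ts; have s0 : 0 <= s - t by rewrite subr_ge0.
  rewrite -[p s - p t](subrK ((s - t) *: F (p t))).
  apply: le_normW (le_normD (fwd _ _ sT tT ts) (le_normZ _ (F_bound (pB _ tT)))).
  rewrite (ger0_norm s0) /A1 [leRHS]mulrDl [bF * _]mulrC lerD2r expr2 mulrA ler_wpM2r//.
  by rewrite ler_wpM2l//; case/andP: sT => _ sT; case/andP: tT => tT _; lra.
have lip s t : 0 <= s <= T -> 0 <= t <= T -> le_norm (p s - p t) (A1 * `|s - t|).
  move=> sT tT; have [ts|/ltW st] := leP t s; first exact: lip_fwd.
  by rewrite -opprB distrC; apply: le_normN; exact: lip_fwd.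
have LA0 : 0 <= L * A1 by exact: mulr_ge0.
exists (A1 + (A0 + L * A1)) => [|s t sT tT]; first exact: addr_ge0 A10 (addr_ge0 A00 LA0).
split.
  by apply: le_normW (lip s t sT tT); rewrite ler_wpM2r// lerDl addr_ge0.
apply: (@le_normW _ ((A0 + L * A1) * (s - t) ^+ 2)).
  by rewrite ler_wpM2r ?sqr_ge0// lerDr.
rewrite mulrDl; have [ts|/ltW st] := leP t s.
  by apply: le_normW (fwd _ _ sT tT ts); rewrite lerDl mulr_ge0 ?sqr_ge0.
have -> : p s - p t - (s - t) *: F (p t) =
    - (p t - p s - (t - s) *: F (p s)) + (t - s) *: (F (p t) - F (p s)).
  by rewrite -[s - t]opprB scaleNr opprK scalerBr !opprB [RHS]addrC addrA subrK addrC.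
have t0 : 0 <= t - s by rewrite subr_ge0.
have FL := F_lipschitz (pB _ tT) (pB _ sT) (lip t s tT sT).
apply: le_normW (le_normD (le_normN (fwd _ _ tT sT st)) (le_normZ _ FL)).
rewrite -[(s - t) ^+ 2]sqrrN opprB lerD2l (ger0_norm t0).
by rewrite le_eqVlt; apply/orP; left; apply/eqP; ring.
Qed.

End euler_scheme.

(** * Existence and uniqueness of the flow *)

Section solutions.
Context {R : realType} {d n : nat}.
Variables (O : 'I_n -> sample R d) (sigma : R) (H : set (sample R d -> R))
  (ip : (sample R d -> R) -> (sample R d -> R) -> R) (alpha M M_K M1a T : R).
Hypotheses (n_gt0 : (0 < n)%N) (sigma_gt0 : 0 < sigma).
Local Notation K := (@gauss_kernel R d sigma).
Local Notation mu := (sample_measure R d).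
Hypotheses (HK : is_rkhs K H ip) (alpha_gt0 : 0 < alpha) (alpha_le1 : alpha <= 1).
Hypothesis M_K_def : kernel_C1a_sup alpha K = M_K%:E.
Hypothesis M1a_def : centered_C1a_sup alpha K H ip O M = M1a%:E.
Implicit Types (o : sample R d) (p q : sample R d -> R).
Local Notation B := (@density_ball R d alpha M).
Local Notation F := (vector_field K H ip O).
Local Notation Calg := (1 + 2 * hoelder_diam (R := R) (d := d) alpha).

Lemma density_ball_complete (u_ : nat -> sample R d -> R) : (forall m, B (u_ m)) ->
  (forall eps, 0 < eps -> exists N, forall m k, (N <= m)%N -> (N <= k)%N ->
     C1a_le alpha (u_ m - u_ k) eps) ->
  exists2 u, B u & forall eps, 0 < eps -> exists N, forall m, (N <= m)%N ->
    C1a_le alpha (u_ m - u) eps.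
Proof.
move=> uB ucau; have uM m : C1a_le alpha (u_ m) M by have /density_ballP[] := uB m.
have [|u ulim] := C1a_complete _ ucau; first by move=> m; exists M.
exists u => //; apply/density_ballP.
have uMu : C1a_le alpha u M.
  apply: C1a_le_closed => eps /ulim[N /(_ _ (leqnn N)) uN].
  by rewrite -[u](subKr (u_ N)); exact: C1a_leB.
split=> // [z|].
- apply/ler_addgt0Pr => eps /ulim[N /(_ _ (leqnn N))/(C1a_le_abs z)].
  have /density_ballP[_ /(_ z) uN0 _] := uB N.
  by rewrite !fctE ler_norml; lra.
- have bu : bounded_measurable u by exact: C1a_le_bm uMu.
  apply/eqP; rewrite eq_sym -subr_eq0 -normr_le0; apply/ler_addgt0Pr => eps e0.
  have Z0 := @total_mass_ge0 R d.
  have Z1 : 0 < total_mass (R := R) (d := d) + 1 by rewrite ltr_wpDl.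
  have [N /(_ _ (leqnn N)) uN] := ulim _ (divr_gt0 e0 Z1).
  have [[bN _ _] [_ _ <-]] := (density_ball_density (uB N), iffLR (density_ballP _ _ _) (uB N)).
  rewrite -bm_intB// add0r.
  apply: le_trans (bm_int_bound (bmB bN bu) (fun o => C1a_le_abs o uN)) _.
  by rewrite mulrAC ler_pdivrMr//; apply: ler_wpM2l; [exact: ltW|rewrite lerDl].
Qed.

(** Evaluation at a point is bounded by the norm, so a C^1 curve of functions is
    differentiable at each point of the sample space. *)
Lemma curve_deriv_within (p p' : R -> sample R d -> R) t o : C1_curve alpha T p p' ->
  0 <= t <= T -> deriv_within 0 T (fun s => p s o) t (p' t o).
Proof.
case=> pC pd _ tT; apply/cvgrPdist_le => eps e0.
have /cvg_sample_norm : \forall s \near within `[0, T] t^',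
    in_C1a alpha (fun o => (p s o - p t o) / (s - t) - p' t o).
  apply/near_within_itv; exists 1 => // s sT _ _; apply/in_C1aP.
  have [/in_C1aP[c ps] _] := pC s sT; have [/in_C1aP[c' pt] /in_C1aP[c'' p't]] := pC t tT.
  exists (`|(s - t)^-1| * (c + c') + c'').
  rewrite (_ : (fun o => _) = (s - t)^-1 *: (p s - p t) - p' t).
    by apply: C1a_leB => //; apply: C1a_leZ; exact: C1a_leB.
  by apply/funext => z; rewrite !fctE mulrC.
move=> /iffLR/(_ (pd t tT) _ e0); apply: filterS => s /(C1a_le_abs o).
by rewrite distrC.
Qed.

(** Two solutions that agree up to time [a] agree a little longer.  The vector
    field is Lipschitz for the supremum distance, so on an interval of length
    [tau] with [L * tau <= 1 / 2] the mean value theorem, applied at each point of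
    the sample space, halves any bound for the distance of the solutions. *)
Lemma solution_unique p0 (p q : R -> sample R d -> R) :
  is_solution alpha K H ip O M T p0 p -> is_solution alpha K H ip O M T p0 q ->
  forall t, 0 <= t <= T -> q t = p t.
Proof.
move=> [pB pC pp0] [qB qC qp0].
have [L L0 FL] := vector_field_sup_lipschitz n_gt0 sigma_gt0 HK alpha_gt0 M_K_def M1a_def.
pose tau := (2 * L + 1)^-1.
have tau0 : 0 < tau by rewrite invr_gt0 ltr_wpDl// mulr_ge0.
have Ltau : L * tau <= 2^-1.
  by rewrite ler_pdivrMr ?ltr_wpDl ?mulr_ge0//; lra.
suff agree k t : 0 <= t <= T -> t <= k%:R * tau -> close_to (q t) (p t) 0.
  move=> t tT; apply/funext => o; apply/eqP; rewrite -subr_eq0 -normr_le0.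
  apply: (agree (Num.truncn (t / tau)).+1 t tT).
  by rewrite -ler_pdivrMr// ltW// truncnS_gt.
elim: k t => [t /andP[t0 _]|k ih t tT tk].
  rewrite mul0r => t0' o; have -> : t = 0 by apply/eqP; rewrite eq_le t0'.
  by rewrite pp0 qp0 subrr normr0.
have halving j t' : 0 <= t' <= T -> t' <= k.+1%:R * tau ->
    close_to (q t') (p t') (2 * `|M| / 2 ^+ j).
  elim: j t' => [|j jh] s sT sk o.
    rewrite expr0 divr1; apply: le_trans (ler_normB _ _) _.
    have [/density_ballP[qM _ _] /density_ballP[pM _ _]] := (qB s sT, pB s sT).
    have := C1a_le_abs o qM; have := C1a_le_abs o pM; have := ler_norm M; lra.
  set D := 2 * `|M| / 2 ^+ j in jh.
  have D0 : 0 <= D by rewrite divr_ge0// ?mulr_ge0// exprn_ge0.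
  have -> : 2 * `|M| / 2 ^+ j.+1 = D * 2^-1 by rewrite exprS invfM mulrA mulrAC.
  have [sk'|ks] := leP s (k%:R * tau).
    by apply: le_trans (ih s sT sk' o) _; rewrite mulr_ge0.
  pose a := k%:R * tau.
  have a0 : 0 <= a by rewrite mulr_ge0// ltW.
  have aT : 0 <= a <= T by rewrite a0/= (le_trans (ltW ks))//; case/andP: sT.
  have qd t' : 0 <= t' <= T -> deriv_within 0 T (fun s => q s o - p s o) t' (F (q t') o - F (p t') o).
    move=> t'T; have dq := curve_deriv_within (o := o) qC t'T; have dp := curve_deriv_within (o := o) pC t'T.
    rewrite /deriv_within.
    have -> : (fun s => (q s o - p s o - (q t' o - p t' o)) / (s - t')) =
      (fun s => (q s o - q t' o) / (s - t') - (p s o - p t' o) / (s - t')).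
      by apply/funext => r; rewrite -mulrBl; congr (_ / _); ring.
    exact: cvgB.
  have := @mean_value_bound _ 0 T _ _ 0 (L * D) a s qd aT sT.
  have := ih a aT (lexx _) o; rewrite normr_le0 => /eqP ->.
  rewrite mul0r !subr0 => /(_ _)/(le_trans _) h.
  apply: (@le_trans _ _ (L * D * `|s - a|)).
    apply: h => // r rT ra; rewrite subr0; apply: FL; [exact: qB|exact: pB|].
    apply: jh => //; move: ra; rewrite (gtr0_norm (x := s - a)) ?subr_gt0// ler_norml; lra.
  rewrite gtr0_norm ?subr_gt0// -[L * D]mulrC -mulrA ler_wpM2l//.
  apply: le_trans Ltau; rewrite ler_wpM2l//.
  by move: sk; rewrite -natr1 mulrDl mul1r /a; lra.
move=> o; apply/ler_addgt0Pr => eps e0; rewrite add0r.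
pose j := (Num.truncn (2 * `|M| / eps)).+1.
apply: le_trans (halving j t tT tk o) _.
rewrite ler_pdivrMr ?exprn_gt0// -ler_pdivrMl// mulrC.
apply/ltW/(lt_trans (truncnS_gt _)); rewrite -/j -natrX ltr_nat; exact: ltn_expl.
Qed.

(** The radius [M] is exactly the bound that the product estimate yields for
    Euler polygons up to time [T], so they remain in the ball. *)
Lemma solution_exists p0 (M0 : R) : 0 <= T -> B p0 -> C1a_le alpha p0 M0 ->
  M = M0 * expR (Calg * M1a * T) ->
  exists p : R -> sample R d -> R, is_solution alpha K H ip O M T p0 p.
Proof.
move=> T0 Bp0 pM0 M_def.
have M1a0 : 0 <= M1a.
  exact: (M1a_ge0 n_gt0 sigma_gt0 HK alpha_gt0 M_K_def M1a_def Bp0).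
have D0 := @hoelder_diam_ge0 R d alpha.
set Lam := Calg * M1a in M_def.
have Lam0 : 0 <= Lam by rewrite mulr_ge0// addr_ge0// mulr_ge0.
have [L L0 FL] := vector_field_lipschitz n_gt0 sigma_gt0 HK alpha_gt0 alpha_le1 M_K_def M1a_def.
have M00 := C1a_le_ge0 pM0.
have M0' : 0 <= M by have /density_ballP[/C1a_le_ge0] := Bp0.
have [N0 hN0] : exists N0, T * M1a <= (2 ^ N0)%:R.
  exists (Num.truncn (T * M1a)).+1.
  by apply/ltW/(lt_le_trans (truncnS_gt _)); rewrite ler_nat ltnW// ltn_expl.
have einv m k : (k <= 2 ^ (N0 + m))%N -> B (euler F T p0 N0 m k) /\
    C1a_le alpha (euler F T p0 N0 m k) (M0 * (1 + step T N0 m * Lam) ^+ k).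
  have h0 := step_ge0 N0 T0 m.
  have hM : step T N0 m * M1a <= 1.
    rewrite mulrAC ler_pdivrMr ?ltr0n ?expn_gt0// mul1r (le_trans hN0)// ler_nat.
    by rewrite leq_exp2l// leq_addr.
  elim: k => [_|k ih km]; first by rewrite expr0 mulr1.
  have [Bk ck] := ih (ltnW km).
  rewrite exprSr mulrA; apply: (euler_step_ball n_gt0 sigma_gt0 HK alpha_gt0 alpha_le1 M_K_def M1a_def) => //.
  rewrite -mulrA -exprSr M_def ler_wpM2l//.
  apply: (@le_trans _ _ (expR (step T N0 m * Lam) ^+ k.+1)).
    have hL : 0 <= 1 + step T N0 m * Lam by rewrite addr_ge0// mulr_ge0.
    by apply: lerXn2r; rewrite ?nnegrE ?expR_ge0 ?expR_ge1Dx.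
  rewrite -expRM_natl ler_expR mulrA mulrC ler_wpM2l//.
  by rewrite -[leRHS](step_total T N0 m) mulrC ler_wpM2l// ler_nat.
have bF0 : 0 <= Calg * (M * M1a) by rewrite !mulr_ge0 ?addr_ge0 ?mulr_ge0.
have sep (u : sample R d -> R) : (forall eps, 0 < eps -> C1a_le alpha u eps) -> u = 0.
  move=> u0; apply/funext => o; apply/eqP; rewrite -normr_le0.
  by apply/ler_addgt0Pr => eps e0; rewrite add0r (C1a_le_abs o (u0 _ e0)).
have Fb p : B p -> C1a_le alpha (F p) (Calg * (M * M1a)).
  move=> Bp; have [pM _ _] := iffLR (density_ballP _ _ _) Bp.
  exact: (vector_field_C1a n_gt0 sigma_gt0 HK alpha_gt0 alpha_le1 M_K_def M1a_def).
have [p [pp0 pB [A A0 pA]]] := euler_solution (@C1a_leW R d alpha)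
  (@C1a_leD R d alpha) (@C1a_leZ R d alpha) (@C1a_le_closed R d alpha) sep
  bF0 L0 T0 density_ball_complete Fb FL (fun m k km => (einv m k km).1).
have FC t : 0 <= t <= T -> C1a_le alpha (F (p t)) (Calg * (M * M1a)).
  by move=> tT; apply: Fb; exact: pB.
have pC t : 0 <= t <= T -> C1a_le alpha (p t) M.
  by move=> /pB/density_ballP[].
have A1 : 0 < A + 1 by rewrite ltr_wpDl.
exists p; split=> //; split.
- by move=> t tT; split; apply/in_C1aP; [exists M; exact: pC|exists (Calg * (M * M1a)); exact: FC].
- move=> t tT.
  have quot s : s != t -> (fun o => (p s o - p t o) / (s - t) - F (p t) o) =
      (s - t)^-1 *: (p s - p t - (s - t) *: F (p t)).
    move=> st; apply/funext => o; rewrite !fctE -[_ *: _]/(_ * _) -[(s - t) *: _]/(_ * _).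
    by field; rewrite subr_eq0.
  apply/cvg_sample_norm => [|eps e0].
    apply/near_within_itv; exists 1 => // s sT st _; rewrite quot//; apply/in_C1aP.
    by have [_ h] := pA s t sT tT; eexists; exact: C1a_leZ h.
  apply/near_within_itv; exists (eps / (A + 1)); first exact: divr_gt0.
  move=> s sT st ste; rewrite quot//; have [_ h] := pA s t sT tT.
  apply: C1a_leW (C1a_leZ (s - t)^-1 h).
  have st0 : `|s - t| != 0 by rewrite normr_eq0 subr_eq0.
  rewrite normfV -[(s - t) ^+ 2]real_normK ?num_real//.
  rewrite [_ * (A * _)](_ : _ = A * `|s - t|); last by field.
  move: ste; rewrite ler_pdivlMr// => ste; apply: le_trans ste.
  by rewrite mulrC ler_wpM2l// lerDl.
- move=> t tT.
  have Fst s : 0 <= s <= T -> C1a_le alpha (F (p s) - F (p t)) (L * (A * `|s - t|)).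
    by move=> sT; apply: FL; [exact: pB|exact: pB|exact: (pA s t sT tT).1].
  apply/cvg_sample_norm => [|eps e0]; rewrite near_withinE; apply/nbhs_ballP.
    exists 1 => //= s _; rewrite in_itv/= => sT; apply/in_C1aP.
    by eexists; exact: Fst s sT.
  have LA1 : 0 < L * A + 1 by rewrite ltr_wpDl// mulr_ge0.
  exists (eps / (L * A + 1)) => /=; first exact: divr_gt0.
  move=> s; rewrite /ball/= distrC ltr_pdivlMr// => ste; rewrite in_itv/= => sT.
  apply: C1a_leW (Fst s sT); apply/ltW/(le_lt_trans _ ste).
  by rewrite mulrA mulrC ler_wpM2l// lerDl.
Qed.

End solutions.

Lemma gauss_kernel_sup (R : realType) (d : nat) (sigma : R) :
  kernel_sup (@gauss_kernel R d sigma) = 1%:E.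
Proof.
apply/eqP; rewrite eq_le; apply/andP; split.
  by apply: ge_ereal_sup => _ [z _ <-]; rewrite gauss_kernel_diag.
pose o : sample R d := ([tuple (toI 0) | _ < d], true, true).
by apply: ereal_sup_ubound; exists o => //; rewrite gauss_kernel_diag.
Qed.

Theorem theorem6p1 (R : realType) (d n : nat) (n_gt0 : (0 < n)%N)
    (O : 'I_n -> sample R d)
    (sigma : R) (sigma_gt0 : 0 < sigma)
    (H : set (sample R d -> R))
    (ip : (sample R d -> R) -> (sample R d -> R) -> R)
    (H_rkhs : is_rkhs (gauss_kernel sigma) H ip)
    (alpha : R) (alpha_gt0 : 0 < alpha) (alpha_le1 : alpha <= 1)
    (M : R) (M_gt0 : 0 < M)
    (C M_K M1a : R)
    (C_def : kernel_sup (@gauss_kernel R d sigma) = C%:E)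
    (M_K_def : kernel_C1a_sup alpha (@gauss_kernel R d sigma) = M_K%:E)
    (M1a_def : centered_C1a_sup alpha (gauss_kernel sigma) H ip O M = M1a%:E)
    (delta : R) (delta_gt0 : 0 < delta)
    (p0 : sample R d -> R) (p0_ball : density_ball alpha M p0)
    (M0 : R) (M0_def : sample_norm alpha p0 = M0%:E)
    (w : R) (w_def : w = delta / (2 * C * M1a))
    (mass_gt0 : forall k : 'I_n,
      0 < \int[sample_measure R d]_(o in slice_ball (O k) w) p0 o)
    (J : R) (J_def : J = inv_mass_max O p0 w)
    (T : R) (T_def : T = 2 / delta * ln (2 * J))
    (Calg : R) (Calg_def : Calg = 1 + 2 * d%:R `^ ((1 - alpha) / 2))
    (M_def : M = M0 * expR (Calg * C * M1a * T)) :
  exists2 p : R -> sample R d -> R,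
    is_solution alpha (gauss_kernel sigma) H ip O M T p0 p &
    forall q : R -> sample R d -> R,
      is_solution alpha (gauss_kernel sigma) H ip O M T p0 q ->
      forall t, 0 <= t <= T -> q t = p t.
Proof.
have C1 : C = 1 by apply: EFin_inj; rewrite -C_def gauss_kernel_sup.
have [T0|T0] := ltP T 0.
  (* The time interval is empty: only the initial value is prescribed. *)
  have empty t : 0 <= t <= T -> False by move=> /andP[t0 /(le_trans t0)]; rewrite leNgt T0.
  exists (fun=> p0) => [|q _ t /empty//].
  by split=> [t /empty//||//]; split=> t /empty.
have /density_ballP[pM _ _] := p0_ball.
have pM0 : C1a_le alpha p0 M0.
  by apply/C1a_leP; split; [exact: (iffLR (C1a_leP _ _ _) pM).1|rewrite M0_def].
have [|p psol] := solution_exists n_gt0 sigma_gt0 H_rkhs alpha_gt0 alpha_le1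
  M_K_def M1a_def T0 p0_ball pM0.
  by rewrite M_def Calg_def C1 mulr1.
exists p => // q qsol t tT.
exact: (solution_unique n_gt0 sigma_gt0 H_rkhs alpha_gt0 M_K_def M1a_def psol qsol).
Qed.
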